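(* Let $Q=(q_0,\dots,q_n)$ be a tuple of positive integers with $\gcd(q_0,\dots,q_n)=1$, let $\mathbf{P}(Q)=\mathbf{P}^n_{q_0,\dots,q_n}$ be the weighted projective space of type $Q$, and let $\Xi$ be its fan, with ray generators $v_0,\dots,v_n$. Let $\tau=(v_0,\dots,v_{i-1})$ be a cone in $\Xi$, so that $\overline{O}_\tau=\mathbf{P}(Q_\tau)$ with $Q_\tau=(q_i,\dots,q_n)$, and let $d=\gcd(q_i,\dots,q_n)$. Then $\overline{O}_\tau=\mathbf{P}(Q_\tau)$ is a twisted sector of $\mathbf{P}(Q)$ if and only if $(q_i,\dots,q_n)$ is the maximal subset of $(q_0,\dots,q_n)$ with greatest common divisor $d$ (that is, no strictly larger subfamily of the weights containing $q_i,\dots,q_n$ has greatest common divisor $d$).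
   Context: Fan. Let $N=\mathbf{Z}^n$ and $d_{0\cdots j}=\gcd(q_0,\dots,q_j)$. Let $(c_{ij})_{1\le i,j\le n}$ be the upper triangular integer matrix with $c_{jj}=d_{0\cdots (j-1)}/d_{0\cdots j}$ and, for fixed $j\geq 2$ and successively $i=j-1,\dots,1$, $c_{ij}$ the smallest non-negative integer with $c_{ij}q_i+\sum_{\nu=i+1}^{j}c_{\nu j}q_\nu\in d_{0\cdots(i-1)}\mathbf{Z}$. Let $v_1,\dots,v_n\in N$ be its rows and $v_0=-\sum_{i=1}^n\frac{q_i}{q_0}v_i\in N$, so $\sum_{i=0}^n q_iv_i=0$. The fan $\Xi$ is the complete fan in $N\otimes\mathbf{R}$ whose cones are generated by the proper subsets of $\{v_0,\dots,v_n\}$; $\mathbf{P}(Q)$ is its toric variety $X_\Xi$. $(v_{j_1},\dots,v_{j_s})$ denotes the cone generated by these vectors; $O_\tau$ is the torus orbit corresponding to $\tau$ (of dimension $n-\dim\tau$) and $\overline{O}_\tau$ its closure. Orbifold structure. For an $n$-dimensional cone $\sigma$ let $N_\sigma\subset N$ be the sublattice generated by the $v_j$ that generate $\sigma$, and $G_\sigma=N/N_\sigma$. Each element of $G_\sigma$ is uniquely represented by a vector $g_a=\sum_{v_j\in\sigma}a_jv_j\in N$ with $a_j\in[0,1)$; it acts on $U_{\sigma'}\cong\mathbf{C}^n$ by the diagonal matrix with entries $e^{2\pi i a_j}$, and $U_\sigma=U_{\sigma'}/G_\sigma$ is the affine open subset of $X_\Xi$ attached to $\sigma$. The local group at a point of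 $O_\tau$ is $G_\tau=\{\sum_{v_j\in\tau}a_jv_j\in N: a_j\in[0,1)\}$. Twisted sectors. For the orbifold $X=\mathbf{P}(Q)$ with local groups $G_p$, let $\widetilde X_1=\{(p,(g)_{G_p}): p\in X,\ g\in G_p\}$, where $(g)_{G_p}$ is the conjugacy class; its connected components are denoted $X_{(g)}$, and those with $g\ne 1$ are the twisted sectors. A twisted sector is identified with its image in $X$ under $(p,(g))\mapsto p$; ''$\overline{O}_\tau$ is a twisted sector'' means that $\overline{O}_\tau$ is the image of some $X_{(g)}$ with $g\neq 1$. *)

(* Defs.v *)
From HB Require Import structures.
From Stdlib Require Import Relations.
From mathcomp Require Import all_boot all_order all_algebra generic_quotient.
From mathcomp Require Import complex.
From mathcomp Require Import all_classical all_reals all_analysis.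
From mathcomp Require Import lra zify.

Set Implicit Arguments.
Unset Strict Implicit.
Unset Printing Implicit Defensive.

Import Order.TTheory GRing.Theory Num.Theory numFieldNormedType.Exports.

Local Open Scope quotient_scope.
Local Open Scope classical_set_scope.
Local Open Scope complex_scope.
Local Open Scope ring_scope.

Section FanOfWeights.
Variables (n : nat) (q : n.+1.-tuple nat).

Definition gcd_weights (J : {set 'I_n.+1}) : nat :=
  \big[gcdn/0%N]_(j in J) tnth q j.

Local Notation w := (nth 0%N q).

(* d_{0...j} *)
Definition initial_gcd (j : nat) : nat :=
  \big[gcdn/0%N]_(0 <= l < j.+1) w l.

Definition least_nat (P : pred nat) : nat :=
  if pselect (exists m, P m) is left exP then ex_minn exP else 0%N.

(* fan_column j k = [:: c_{j-k,j}; ...; c_{jj}] for 0 <= k < j, with rows and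
   columns numbered from 1. *)
Fixpoint fan_column (j k : nat) : seq nat :=
  if k is k'.+1 then
    let s := fan_column j k' in
    let i := (j - k)%N in
    least_nat (fun c =>
      (initial_gcd i.-1 %|
         c * w i + \sum_(l < k) nth 0%N s l * w (i.+1 + l))%N) :: s
  else [:: (initial_gcd j.-1 %/ initial_gcd j)%N].

Definition fan_matrix : 'M[int]_n :=
  \matrix_(a < n, b < n)
    if (a <= b)%N then (nth 0%N (fan_column b.+1 (b - a)) 0)%:Z else 0.

(* v_0, ..., v_n; the division by q_0 defining v_0 is exact, see
   fan_ray_relation. *)
Definition fan_ray (j : 'I_n.+1) : 'rV[int]_n :=
  if unlift ord0 j is Some l then row l fan_matrix
  else \row_k - ((\sum_(l < n) (w l.+1)%:Z * fan_matrix l k) %/ (w 0)%:Z)%Z.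

Lemma initial_gcdS j : initial_gcd j.+1 = gcdn (initial_gcd j) (w j.+1).
Proof. by rewrite /initial_gcd big_nat_recr. Qed.

Lemma least_natP (P : pred nat) : (exists m, P m) -> P (least_nat P).
Proof. by move=> exP; rewrite /least_nat; case: pselect => // e; case: ex_minnP. Qed.

Hypothesis q_gt0 : forall j, (0 < tnth q j)%N.

Lemma w_gt0 j : (j <= n)%N -> (0 < w j)%N.
Proof. by move=> jn; rewrite -[j]/(val (Ordinal (jn : j < n.+1)%N)) -tnth_nth. Qed.

Lemma initial_gcd_gt0 j : (j <= n)%N -> (0 < initial_gcd j)%N.
Proof.
case: j => [|j] jn; first by rewrite /initial_gcd big_nat1 w_gt0.
by rewrite initial_gcdS gcdn_gt0 (w_gt0 jn) orbT.
Qed.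

Lemma size_fan_column j k : size (fan_column j k) = k.+1.
Proof. by elim: k => //= k ->. Qed.

Lemma nth_fan_column j k l : (l <= k)%N ->
  nth 0%N (fan_column j k) l = nth 0%N (fan_column j (k - l)) 0.
Proof. by elim: l k => [|l IH] [|k] //= lk; rewrite IH ?subSS. Qed.

Lemma fan_column_dvd j k : (j <= n)%N -> (k < j)%N ->
  (initial_gcd (j - k).-1 %|
     \sum_(l < k.+1) nth 0%N (fan_column j k) l * w (j - k + l))%N.
Proof.
move=> jn; elim: k => [|k IH] kj.
  rewrite subn0 big_ord_recl big_ord0 addn0 /= addn0.
  case: j kj jn => // j _ jn.
  rewrite succnK initial_gcdS mulnC -muln_divCA_gcd.
  exact: dvdn_mulr.
set i := (j - k.+1)%N; have ji : (j - k)%N = i.+1 by rewrite subnSK// ltnW.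
have := IH (ltnW kj); rewrite ji succnK => {}IH.
rewrite big_ord_recl addn0.
under eq_bigr do rewrite lift0 addnS -addSn.
rewrite [fan_column j k.+1]/= -/i [nth _ _ ord0]/=.
 apply: (@least_natP (fun c => initial_gcd i.-1 %| c * w i +
  \sum_(l < k.+1) nth 0 (fan_column j k) l * w (i.+1 + l))%N).
have : (0 < i)%N by rewrite subn_gt0.
have : (i <= n)%N by rewrite (leq_trans _ jn)// leq_subr.
move: IH; case: i {ji} => // i IH iN _.
rewrite /= in IH *; move: IH; rewrite initial_gcdS.
have D0 := initial_gcd_gt0 (ltnW iN); set D := initial_gcd i in D0 *.
set S := (\sum_(_ < _) _)%N; rewrite gcdnC => /dvdnP[S' ->].
have [km kn e _] := egcdnP D (w_gt0 iN).
exists (km * (S' * D.-1))%N.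
rewrite mulnAC e -[X in (X %| _)%N]/D.
have -> : ((kn * D + gcdn (w i.+1) D) * (S' * D.-1) + S' * gcdn (w i.+1) D =
   (kn * (S' * D.-1) + S' * gcdn (w i.+1) D) * D)%N.
  by case: (D) D0 => // D1 _ /=; lia.
exact: dvdn_mull.
Qed.

Lemma fan_ray_relation : \sum_j (tnth q j)%:Z *: fan_ray j = 0.
Proof.
apply/rowP => k; rewrite summxE mxE big_ord_recl !mxE /fan_ray unlift_none mxE.
rewrite (tnth_nth 0%N) mulrN mulrC divzK; last first.
  have : (w 0 %| \sum_(l < k.+1) nth 0 (fan_column k.+1 k) l * w l.+1)%N.
    have := fan_column_dvd (ltn_ord k) (ltnSn k).
    rewrite subSnn /= /initial_gcd big_nat1; congr (_ %| _)%N.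
  congr (_ %| _)%N; rewrite -[LHS]absz_nat; congr absz.
  rewrite (big_ord_widen n (fun l => nth 0 (fan_column k.+1 k) l * w l.+1)%N)//.
  rewrite -natz natr_sum big_mkcond; apply: eq_bigr => l _; rewrite mxE ltnS.
  case: ifP => lk; last by rewrite mulr0.
  by rewrite nth_fan_column// natrM mulrC !natz.
rewrite addrC; apply/eqP; rewrite subr_eq0; apply/eqP/eq_bigr => l _.
by rewrite !mxE liftK !mxE (tnth_nth 0%N).
Qed.

End FanOfWeights.

Section ToricVariety.
Variables (R : realType) (n : nat).
Local Notation C := (R[i]^o).
Local Notation N := 'rV[int]_n.
Local Notation M := 'cV[int]_n.
Local Notation NR := 'rV[R]_n.

Definition lattice_point (v : N) : NR := map_mx intr v.

Definition pairing (x : NR) (m : M) : R := (x *m map_mx intr m) 0 0.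

Definition dual_monoid (s : set NR) : set M :=
  [set m | forall x, s x -> 0 <= pairing x m].

Definition perp (s : set NR) : set M :=
  [set m | forall x, s x -> pairing x m = 0].

(* U_s = Hom(dual_monoid s, C) with the topology of pointwise convergence, a
   homomorphism being extended by 0 outside of dual_monoid s. *)
Definition affine_toric (s : set NR) : set {ptws M -> C} :=
  [set f | [/\ f 0 = 1,
     (forall m m', dual_monoid s m -> dual_monoid s m' ->
        f (m + m') = f m * f m')
     & forall m, ~ dual_monoid s m -> f m = 0]].

Lemma pairing_lattice (v : N) (m : M) :
  pairing (lattice_point v) m = ((v *m m) 0 0)%:~R.
Proof. by rewrite /pairing -map_mxM mxE. Qed.

Lemma pairingD (x : NR) (m m' : M) :
  pairing x (m + m') = pairing x m + pairing x m'.
Proof. by rewrite /pairing map_mxD mulmxDr mxE. Qed.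

Variable Xi : set (set NR).

Definition affine_pieces := {s : Xi & affine_toric (set_val s)}.
HB.instance Definition _ := Topological.on affine_pieces.

Definition glue (x y : affine_pieces) : Prop :=
  exists2 f, affine_toric (set_val (tag x) `&` set_val (tag y)) f &
    (forall m, dual_monoid (set_val (tag x)) m ->
       (set_val (tagged x) : M -> C) m = f m) /\
    (forall m, dual_monoid (set_val (tag y)) m ->
       (set_val (tagged y) : M -> C) m = f m).

Definition glue_equiv (x y : affine_pieces) : bool :=
  `[< clos_refl_sym_trans _ glue x y >].

Lemma glue_equiv_refl : reflexive glue_equiv.
Proof. by move=> x; apply/asboolP/rst_refl. Qed.

Lemma glue_equiv_sym : symmetric glue_equiv.
Proof.
by move=> x y; apply/asboolP/asboolP => ?; apply: rst_sym.
Qed.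

Lemma glue_equiv_trans : transitive glue_equiv.
Proof.
move=> y x z /asboolP xy /asboolP yz; apply/asboolP; exact: rst_trans yz.
Qed.

Canonical glue_equivRel :=
  EquivRel glue_equiv glue_equiv_refl glue_equiv_sym glue_equiv_trans.

(* X_Xi, for a fan Xi *)
Definition toric_variety := quotient_topology {eq_quot glue_equivRel}.
HB.instance Definition _ := Topological.on toric_variety.

Definition toric_point (x : affine_pieces) : toric_variety :=
  (\pi_(quotient_topology {eq_quot glue_equivRel}) x).

(* the torus Hom(M, C \ {0}) *)
Definition torus : set (M -> C) :=
  [set t | (forall m, t m != 0) /\ forall m m', t (m + m') = t m * t m'].

(* O_s: the torus orbit of the point x_s of U_s with x_s(m) = 1 if
   m \in perp s and x_s(m) = 0 otherwise *)
Definition toric_orbit (s : set NR) : set toric_variety :=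
  [set p | exists x : affine_pieces,
     [/\ toric_point x = p, set_val (tag x) = s
       & exists2 t, torus t & forall m,
           (set_val (tagged x) : M -> C) m = t m * (m \in perp s)%:R]].

End ToricVariety.
Arguments toric_orbit {R n} Xi s _.

Section WeightedProjectiveSpace.
Variables (R : realType) (n : nat) (q : n.+1.-tuple nat).
Local Notation C := (R[i]^o).
Local Notation N := 'rV[int]_n.
Local Notation M := 'cV[int]_n.
Local Notation v := (fan_ray q).

Definition fan_cone (J : {set 'I_n.+1}) : set 'rV[R]_n :=
  [set x | exists2 a : 'I_n.+1 -> R, (forall j, 0 <= a j) &
     x = \sum_(j in J) a j *: lattice_point R (v j)].

Definition fan : set (set 'rV[R]_n) :=
  [set s | exists2 J : {set 'I_n.+1}, J \proper [set: 'I_n.+1]%SET &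
     s = fan_cone J].

(* P(Q) *)
Definition wproj := toric_variety fan.
HB.instance Definition _ := Topological.on wproj.

(* G_s for s = fan_cone J *)
Definition box (J : {set 'I_n.+1}) : set N :=
  [set g | exists2 a : 'I_n.+1 -> R, (forall j, 0 <= a j < 1) &
     lattice_point R g = \sum_(j in J) a j *: lattice_point R (v j)].

(* G_p, as a set of representatives in N: the group law is that of N modulo the
   sublattice spanned by the v_j, j \in J. *)
Definition local_group (p : wproj) : set N :=
  [set g | exists J : {set 'I_n.+1},
     [/\ J \proper [set: 'I_n.+1]%SET,
        toric_orbit fan (fan_cone J) p & box J g]].

(* The n-dimensional cones are the s_k = fan_cone (~: [set k]), generated by
   the v_(lift k j), j : 'I_n. *)
Section Chart.
Variable k : 'I_n.+1.

Definition maximal_cone := fan_cone (~: [set k])%SET.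

(* The quotient map C^n = U_{s'} -> U_s, for s = s_k. It is dual to the
   inclusion of dual_monoid s into the dual monoid N^n of s with respect to
   the sublattice spanned by the v_(lift k j); the exponents are nonnegative
   for m in dual_monoid s. *)
Definition chart_fun (z : 'rV[C]_n) : {ptws M -> C} := fun m =>
  if m \in dual_monoid maximal_cone
  then \prod_(j < n) z 0 j ^+ absz ((v (lift k j) *m m) 0 0) else 0.

Definition expi (x : R) : C := (cos x +i* sin x)%C.

(* diag(e^{2 pi i a_j}) *)
Definition diag_action (a : 'I_n -> R) (z : 'rV[C]_n) : 'rV[C]_n :=
  \row_j (expi (2 * pi * a j) * z 0 j).

Definition box_coordinates (a : 'I_n -> R) (g : N) : Prop :=
  (forall j, 0 <= a j < 1) /\
  lattice_point R g = \sum_(j < n) a j *: lattice_point R (v (lift k j)).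

Lemma maximal_cone_fan : fan maximal_cone.
Proof.
exists (~: [set k])%SET => //; rewrite properT; apply/negP => /eqP E.
by have := finset.in_setT k; rewrite -E !inE eqxx.
Qed.

Lemma pairing_ge0 (m : M) j : dual_monoid maximal_cone m ->
  0 <= (v (lift k j) *m m) 0 0.
Proof.
move=> /(_ (lattice_point R (v (lift k j)))); rewrite pairing_lattice ler0z.
apply; exists (fun i => (i == lift k j)%:R) => [i|]; first by rewrite ler0n.
rewrite (bigD1 (lift k j)) ?inE 1?eq_sym ?neq_lift//= eqxx scale1r big1 ?addr0//.
by move=> i /andP[_ /negPf ->]; rewrite scale0r.
Qed.

Lemma chart_fun_affine z : affine_toric maximal_cone (chart_fun z).
Proof.
split=> [|m m' Sm Sm'|m Sm]; rewrite /chart_fun.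
- rewrite mem_set; last by move=> x _; rewrite /pairing map_mx0 mulmx0 mxE.
  by apply: big1 => j _; rewrite mulmx0 mxE.
- rewrite !mem_set//; last first.
    by move=> x sx; rewrite pairingD addr_ge0 ?(Sm _ sx) ?(Sm' _ sx).
  rewrite -big_split; apply: eq_bigr => j _ /=.
  rewrite -exprD mulmxDr mxE; congr (_ ^+ _).
  have := pairing_ge0 j Sm; have := pairing_ge0 j Sm'.
  by case: ((_ *m m') 0 0) => // p _; case: ((_ *m m) 0 0).
- by rewrite memNset.
Qed.

Definition chart_piece (z : 'rV[C]_n) : affine_pieces fan :=
  existT (fun s : fan => affine_toric (set_val s))
    (SigSub (mem_set maximal_cone_fan)) (SigSub (mem_set (chart_fun_affine z))).

Definition chart (z : 'rV[C]_n) : wproj := toric_point (chart_piece z).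

(* chart z lies in O_s for s generated by the v_(lift k j) with z_j = 0 *)
Definition zero_face (z : 'rV[C]_n) : {set 'I_n.+1} :=
  [set lift k j | j in [pred j | z 0 j == 0]]%SET.

Lemma zero_face_proper z : zero_face z \proper [set: 'I_n.+1]%SET.
Proof.
rewrite properT; apply/negP => /eqP E.
have := finset.in_setT k; rewrite -E => /imsetP[j _ kj].
by have := neq_lift k j; rewrite -kj eqxx.
Qed.

Lemma fan_ray_cone (J : {set 'I_n.+1}) i :
  i \in J -> fan_cone J (lattice_point R (v i)).
Proof.
move=> iJ; exists (fun l => (l == i)%:R) => [l|]; first by rewrite ler0n.
rewrite (bigD1 i)//= eqxx scale1r big1 ?addr0//.
by move=> l /andP[_ /negPf ->]; rewrite scale0r.
Qed.

Lemma zero_face_perp z m : perp (fan_cone (zero_face z)) m <->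
  forall j, z 0 j = 0 -> (v (lift k j) *m m) 0 0 = 0.
Proof.
split=> [mp j zj|mp x [a a0 ->]].
  have : fan_cone (zero_face z) (lattice_point R (v (lift k j))).
    by apply: fan_ray_cone; apply/imsetP; exists j; rewrite ?inE ?zj.
  by move=> /mp; rewrite pairing_lattice => /eqP; rewrite intr_eq0 => /eqP.
rewrite /pairing mulmx_suml summxE big1// => i /imsetP[j].
rewrite inE => /eqP zj ->; rewrite -scalemxAl mxE.
by have := pairing_lattice R (v (lift k j)) m; rewrite /pairing => ->;
  rewrite mp// mulr0.
Qed.

Definition face_char (z : 'rV[C]_n) (m : M) : C :=
  \prod_(j < n | z 0 j != 0) (z 0 j : R[i]) ^ ((v (lift k j) *m m) 0 0).

Lemma face_char_torus z : torus (face_char z).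
Proof.
split=> [m|m m'].
  by apply/prodf_neq0 => j zj; rewrite expfz_neq0.
rewrite -big_split/=; apply: eq_bigr => j zj.
by rewrite mulmxDr mxE expfzDr.
Qed.

Definition face_fun z : {ptws M -> C} :=
  fun m => face_char z m * (m \in perp (fan_cone (zero_face z)))%:R.

Lemma face_fun_affine z : affine_toric (fan_cone (zero_face z)) (face_fun z).
Proof.
have [_ tD] := face_char_torus z.
split=> [|m m' Sm Sm'|m Sm]; rewrite /face_fun.
- rewrite mem_set; last by move=> x _; rewrite /pairing map_mx0 mulmx0 mxE.
  by rewrite mulr1; apply: big1 => j _; rewrite mulmx0 mxE expr0z.
- rewrite tD mulrACA -natrM mulnb; congr (_ * (nat_of_bool _)%:R).
  apply/idP/andP => [|[]]; rewrite !inE => h; last first.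
    by move=> h' x sx; rewrite pairingD (h _ sx) (h' _ sx) addr0.
  have {}h x (sx : fan_cone (zero_face z) x) :
      (pairing x m == 0) && (pairing x m' == 0).
    rewrite -paddr_eq0 ?(Sm _ sx) ?(Sm' _ sx)//; apply/eqP.
    by rewrite -(h _ sx) pairingD.
  by split=> x /h /andP[/eqP ? /eqP].
- rewrite memNset ?mulr0// => mp; apply: Sm => x /mp ->; exact: lexx.
Qed.

Lemma zero_face_fan z : fan (fan_cone (zero_face z)).
Proof. by exists (zero_face z) => //; exact: zero_face_proper. Qed.

Lemma chart_orbit z : toric_orbit fan (fan_cone (zero_face z)) (chart z).
Proof.
pose y : affine_pieces fan :=
  existT (fun s : fan => affine_toric (set_val s))
    (SigSub (mem_set (zero_face_fan z))) (SigSub (mem_set (face_fun_affine z))).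
exists y; split => //=; last first.
  by exists (face_char z) => //; exact: face_char_torus.
have sub : fan_cone (zero_face z) `<=` maximal_cone.
  move=> x [a a0 ->].
  exists (fun i => if i \in zero_face z then a i else 0).
    by move=> i; case: ifP.
  rewrite [RHS](bigID (mem (zero_face z)))/= [X in _ + X]big1 ?addr0; last first.
    by move=> i /andP[_ /negPf ->]; rewrite scale0r.
  apply: eq_big => [i|i ->//].
  rewrite andbC; case: imsetP => //= -[j _ ->].
  by rewrite !inE eq_sym neq_lift.
apply/esym/eqmodP/asboolP/rst_step.
exists (face_fun z) => /=; first by rewrite setIidr//; exact: face_fun_affine.
split=> // m Sm; rewrite -[LHS]/(chart_fun z m) /chart_fun mem_set//.
have [mp|mp] := boolP (m \in perp (fan_cone (zero_face z))).
    rewrite /face_fun mp mulr1 (bigID (fun j => z 0 j == 0))/= big1 ?mul1r.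
      apply: eq_bigr => j _; have := pairing_ge0 j Sm.
      by case: ((_ *m m) 0 0).
    move: mp; rewrite inE zero_face_perp => mp j /eqP zj.
    by rewrite (mp _ zj).
  rewrite /face_fun (negPf mp) mulr0; apply/eqP/negPn/negP => /prodf_neq0 nz.
  move: mp; rewrite notin_setE; apply; apply/zero_face_perp => j zj.
  have := nz j isT; rewrite zj expf_eq0 eqxx andbT lt0n negbK absz_eq0.
  by move/eqP.
Qed.

Lemma expi_eq1 (a : R) : 0 <= a < 1 -> expi (2 * pi * a) = 1 -> a = 0.
Proof.
move=> /andP[a0 a1] [c1 _]; apply/eqP/negPn/negP => an0.
have ap : 0 < a by rewrite lt_def an0.
have p0 := pi_gt0 R.
have s0 : 0 < sin (pi * a).
  by apply: sin_gt0_pi; rewrite mulr_gt0//= gtr_pMr.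
move: c1; rewrite -mulrA mulr_natl cos_mulr2n cos2sin2 => c1.
have : sin (pi * a) ^+ 2 = 0 by lra.
by apply/eqP; rewrite sqrf_eq0 gt_eqF.
Qed.

Lemma chart_local_group (a : 'I_n -> R) g z : box_coordinates a g ->
  diag_action a z = z -> local_group (chart z) g.
Proof.
move=> [a01 ga] az; exists (zero_face z); split.
- exact: zero_face_proper.
- exact: chart_orbit.
exists (fun i => if unlift k i is Some j then a j else 0) => [i|].
  by case: unlift => [j|]; [exact: a01|rewrite lexx ltr01].
rewrite ga big_imset/=; last by move=> ? ? _ _; exact: lift_inj.
rewrite (bigID (fun j => z 0 j == 0))/= [X in _ + X]big1 ?addr0; last first.
  move=> j zj; rewrite (@expi_eq1 (a j)) ?scale0r//.
  have /rowP/(_ j) := az; rewrite mxE => /eqP.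
  by rewrite -[eqbRHS]mul1r (inj_eq (mulIf zj)) => /eqP.
by apply: eq_bigr => j _; rewrite liftK.
Qed.

End Chart.


(* the space of pairs (p, g) with g \in G_p; the groups G_p are abelian, so
   the conjugacy class of g is {g} *)
Definition inertia : Type := set_type [set x : wproj * N | local_group x.1 x.2].
HB.instance Definition _ := Choice.on inertia.

Definition inertia_point (x : inertia) : wproj := (set_val x).1.
Definition inertia_elt (x : inertia) : N := (set_val x).2.

Definition fixed_locus (a : 'I_n -> R) : set 'rV[C]_n :=
  [set z | diag_action a z = z].

Definition inertia_chart k a g (ag : box_coordinates k a g)
    (z : fixed_locus a) : inertia :=
  SigSub (mem_set (chart_local_group ag (set_mem (valP z)) :
    [set x : wproj * N | local_group x.1 x.2] (chart k (set_val z), g))).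

(* The topology is coinduced by the orbifold charts (C^n)^g of the inertia
   orbifold, for all uniformizing systems (C^n, G_s) and g \in G_s. *)
Definition inertia_open (W : set inertia) : Prop :=
  forall k a g (ag : box_coordinates k a g), open (inertia_chart ag @^-1` W).

Lemma inertia_openT : inertia_open setT.
Proof. by move=> k a g ag; rewrite preimage_setT; exact: openT. Qed.

Lemma inertia_openI : setI_closed inertia_open.
Proof. by move=> U V oU oV k a g ag; rewrite preimage_setI; exact: openI. Qed.

Lemma inertia_open_bigU (I : Type) (f : I -> set inertia) :
  (forall i, inertia_open (f i)) -> inertia_open (\bigcup_i f i).
Proof.
move=> of_ k a g ag; rewrite preimage_bigcup; apply: bigcup_open => i _.
exact: of_.
Qed.

HB.instance Definition _ := isOpenTopological.Build inertia
  inertia_openT inertia_openI inertia_open_bigU.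

(* A is the image of a component X_(g), g <> 1; the identity of G_p is
   represented by the vector 0 *)
Definition is_twisted_sector (A : set wproj) : Prop :=
  exists x : inertia, inertia_elt x != 0 /\
    A = inertia_point @` connected_component setT x.

End WeightedProjectiveSpace.
Arguments fan_cone R {n} q J.
Arguments fan R {n} q.

(* Main.v *)
Require Import Defs.
From mathcomp Require Import all_boot all_order all_algebra.
From mathcomp Require Import generic_quotient complex.
From mathcomp Require Import all_classical all_reals all_analysis.
From mathcomp Require Import ring zify.

(** Write a point of the lattice as a combination of the rays v_j. A nonzero
    lattice vector g lying in some box has a well-defined support, the set J of
    the rays that carry a coefficient in ]0, 1[, and g belongs to the local
    group of a point exactly when that point lies in an orbit O_K with J
    contained in K. The union of these orbits, star J below, is the closure of
    O_J. So the theorem amounts to two facts.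

    - Topology. The component of (p, g) in the inertia space is the set of all
      pairs with second entry g. The second entry is locally constant, which
      gives one inclusion. Conversely the fixed locus of g in each chart is a
      coordinate subspace, hence connected, and every chart that meets star J
      also covers O_J, so these pieces share a point (inertia_componentE).
      The image of the component is therefore star J. Since star J determines
      J (star_inj), the closure of O_J is a twisted sector if and only if the
      interior of the box of J contains a nonzero lattice vector
      (twisted_sectorP).

    - Arithmetic. Let d be the gcd of the weights outside J. If d divides
      none of the weights q_j with j in J, the vector
      sum_(j in J) (q_j mod d)/d v_j has coefficients in ]0, 1[, and it is
      integral because it differs from (1/d) sum_j q_j v_j = 0 by an integral
      combination of the rays. If d divides q_j for some j in J, then Bezout
      gives an integral relation expressing q_j through the weights outside J,
      hence an integral functional that is 1 on v_j and 0 on the other rays of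
      J; it maps a vector of the box to its coefficient along v_j, which is
      then an integer and cannot lie in ]0, 1[. The weights outside J form the
      maximal family with gcd d exactly when d divides none of the others
      (gcd_maximalP).

    The combinatorics of the fan rests on one statement, ray_pairing_surj: the
    values of integral functionals on the rays are all the integral vectors u
    with sum_j q_j u_j = 0. It yields the functionals that separate two cones,
    and the dual bases (up to a factor) of the maximal cones. The point of an
    affine piece given by a monoid morphism f comes from a point of affine
    space (chart_fun_surj) because characters with values in an algebraically
    closed field extend from subgroups of Z^n (extend_character). *)

Set Implicit Arguments.
Unset Strict Implicit.
Unset Printing Implicit Defensive.

Import Order.TTheory GRing.Theory Num.Theory numFieldNormedType.Exports.

Local Open Scope classical_set_scope.
Local Open Scope ring_scope.

(** * Integral functionals with prescribed values on the rays *)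

Lemma dvdn_div_gcd D y x :
  (0 < D)%N -> (D %| y * x)%N -> (D %/ gcdn D y %| x)%N.
Proof.
move=> D0; set g := gcdn D y.
have g0 : (0 < g)%N by rewrite gcdn_gt0 D0.
have gD : (g %| D)%N := dvdn_gcdl D y; have gy : (g %| y)%N := dvdn_gcdr D y.
rewrite -{1}(divnK gD) -{1}(divnK gy) mulnAC dvdn_pmul2r// Gauss_dvdr//.
by rewrite /coprime -(eqn_pmul2r g0) mul1n muln_gcdl !divnK.
Qed.

Section RayPairing.
Variables (n : nat) (q : n.+1.-tuple nat).
Hypothesis q_gt0 : forall j, (0 < tnth q j)%N.

Definition ray_pairing (m : 'cV[int]_n) (j : 'I_n.+1) : int :=
  (fan_ray q j *m m) 0 0.

Lemma ray_pairingD m m' j :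
  ray_pairing (m + m') j = ray_pairing m j + ray_pairing m' j.
Proof. by rewrite /ray_pairing mulmxDr mxE. Qed.

Lemma ray_pairingN m j : ray_pairing (- m) j = - ray_pairing m j.
Proof. by rewrite /ray_pairing mulmxN mxE. Qed.

Lemma ray_pairing0 j : ray_pairing 0 j = 0.
Proof. by rewrite /ray_pairing mulmx0 mxE. Qed.

Lemma ray_pairingZ c m j : ray_pairing (c *: m) j = c * ray_pairing m j.
Proof. by rewrite /ray_pairing -scalemxAr mxE. Qed.

Lemma ray_pairing_sum (I : finType) (P : pred I) (F : I -> 'cV[int]_n) j :
  ray_pairing (\sum_(i | P i) F i) j = \sum_(i | P i) ray_pairing (F i) j.
Proof. by rewrite /ray_pairing mulmx_sumr summxE. Qed.

Lemma ray_pairing_relation m : \sum_j (tnth q j)%:Z * ray_pairing m j = 0.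
Proof.
transitivity (((\sum_j (tnth q j)%:Z *: fan_ray q j) *m m) 0 0).
  rewrite mulmx_suml summxE; apply: eq_bigr => j _.
  by rewrite -scalemxAl [RHS]mxE.
by rewrite fan_ray_relation// mul0mx mxE.
Qed.

Lemma ray_pairing_delta (k : 'I_n) j :
  ray_pairing (delta_mx k 0) j = fan_ray q j 0 k.
Proof.
rewrite /ray_pairing mxE (bigD1 k)//= big1 ?addr0; first by rewrite !mxE !eqxx mulr1.
by move=> l lk; rewrite mxE (negPf lk) mulr0.
Qed.

Lemma initial_gcd_dvd a b : (a <= b)%N -> (initial_gcd q b %| nth 0%N q a)%N.
Proof.
elim: b => [|b IH]; first by rewrite leqn0 => /eqP ->; rewrite /initial_gcd big_nat1.
rewrite leq_eqVlt initial_gcdS => /orP[/eqP ->|]; first exact: dvdn_gcdr.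
by rewrite ltnS => /IH; apply: dvdn_trans; exact: dvdn_gcdl.
Qed.

(** Back-substitution, from the last column of the upper triangular matrix to
    the first. If u vanishes beyond index K+1, then q_(K+1) u_(K+1) is a
    combination of q_0, ..., q_K, hence divisible by d_(0...K), so that u_(K+1)
    is divisible by the diagonal entry d_(0...K) / d_(0...K+1). Subtracting a
    multiple of the corresponding coordinate functional clears u_(K+1) and
    keeps the relation, which every functional satisfies. *)
Lemma ray_pairing_surj (u : 'I_n.+1 -> int) :
  \sum_j (tnth q j)%:Z * u j = 0 -> exists m, forall j, ray_pairing m j = u j.
Proof.
suff main K : forall u : 'I_n.+1 -> int,
    (forall j : 'I_n.+1, (K < j)%N -> u j = 0) ->
    \sum_j (tnth q j)%:Z * u j = 0 -> exists m, forall j, ray_pairing m j = u j.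
  by apply: (main n) => j; rewrite ltnNge -ltnS ltn_ord.
elim: K => [|K IH] {}u u0 qu0.
  have uj0 j : u j = 0.
    case: (posnP j) => [j0|]; last exact: u0.
    move: qu0; rewrite (bigD1 j)//= big1 ?addr0 => [/eqP|i ij].
      by rewrite mulf_eq0; case/orP => [/eqP|/eqP//]; have := q_gt0 j; lia.
    by rewrite u0 ?mulr0// lt0n -[X in _ != X]j0.
  by exists 0 => j; rewrite ray_pairing0 uj0.
case: (leqP K.+1 n) => Kn; last first.
  (* For K >= n there is no index K+1, and nothing to clear. *)
  apply: IH => // j; have := ltn_ord j; lia.
pose k := Ordinal Kn; pose j0 := lift ord0 k.
have j0E : val j0 = K.+1 by [].
set D := initial_gcd q K; have D0 : (0 < D)%N by apply: initial_gcd_gt0 => //; lia.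
have ckk : fan_matrix q k k = (D %/ initial_gcd q K.+1)%N.
  by rewrite mxE leqnn subnn.
have c0 : fan_matrix q k k != 0.
  rewrite ckk initial_gcdS; apply/eqP => -[/eqP].
  by rewrite -leqn0 leqNgt divn_gt0 ?gcdn_gt0 ?D0// dvdn_leq ?dvdn_gcdl.
have Dqu : (D%:Z %| (nth 0%N q K.+1)%:Z * u j0)%Z.
  move: qu0; rewrite (bigD1 j0)//= (tnth_nth 0%N) j0E => /eqP.
  rewrite addr_eq0 => /eqP ->; rewrite rpredN; apply: rpred_sum => j jj0.
  case: (leqP j K) => jK.
    by apply: dvdz_mulr; rewrite (tnth_nth 0%N); exact: initial_gcd_dvd.
  rewrite u0 ?mulr0 ?dvdz0// ltn_neqAle jK andbT -j0E eq_sym.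
  by rewrite (inj_eq val_inj).
have cu : (fan_matrix q k k %| u j0)%Z.
  rewrite ckk initial_gcdS.
  have := Dqu; rewrite !dvdzE abszM !absz_nat.
  exact: dvdn_div_gcd.
pose c := (u j0 %/ fan_matrix q k k)%Z.
have rk (j : 'I_n.+1) : (K.+1 < j)%N -> ray_pairing (delta_mx k 0) j = 0.
  move=> Kj; rewrite ray_pairing_delta /fan_ray.
  case: unliftP Kj => [l ->|-> //]; rewrite lift0 ltnS => kl.
  by rewrite !mxE leqNgt kl.
have [||m Hm] := IH (fun j => u j - c * ray_pairing (delta_mx k 0) j).
- move=> j; rewrite leq_eqVlt => /orP[/eqP jE|Kj]; last first.
    by rewrite u0// rk// mulr0 subr0.
  have -> : j = j0 by exact: val_inj.
  by rewrite ray_pairing_delta /fan_ray /j0 liftK mxE divzK// subrr.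
- under eq_bigr do rewrite mulrBr mulrCA.
  by rewrite sumrB qu0 -mulr_sumr ray_pairing_relation mulr0 subrr.
exists (m + c *: delta_mx k 0) => j.
by rewrite ray_pairingD ray_pairingZ Hm subrK.
Qed.

Lemma sum_indicator (I : finType) (F : I -> int) j :
  \sum_i F i * (i == j)%:R = F j.
Proof.
rewrite (bigD1 j)//= eqxx mulr1 big1 ?addr0// => i /negPf ->.
by rewrite mulr0.
Qed.

(** The simplest relation among the weights, q_j q_k - q_k q_j = 0. For fixed
    k these functionals form a dual basis, up to the factor q_k, of the rays
    other than v_k. *)
Lemma exists_ray_functional (j k : 'I_n.+1) :
  exists m, forall i, ray_pairing m i =
    (tnth q k)%:Z * (i == j)%:R - (tnth q j)%:Z * (i == k)%:R.
Proof.
have weight a b : \sum_i (tnth q i)%:Z * (a * (i == b)%:R) = a * (tnth q b)%:Z.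
  by under eq_bigr do rewrite mulrA; rewrite sum_indicator mulrC.
apply: ray_pairing_surj; under eq_bigr do rewrite mulrBr.
by rewrite sumrB !weight mulrC subrr.
Qed.

(** The functionals of exists_ray_functional for the rays of K outside L, added
    up, with k outside K: the only negative value is taken on v_k. *)
Lemma exists_separating_functional (K L : {set 'I_n.+1}) :
  K \proper [set: 'I_n.+1]%SET -> exists m,
  [/\ forall j, j \in K -> 0 <= ray_pairing m j,
      forall j, j \in L -> ray_pairing m j <= 0
    & forall j, j \in K -> j \notin L -> 0 < ray_pairing m j].
Proof.
move=> /properP[_ [k _ kK]].
have [f fE] := choice (fun j => exists_ray_functional j k).
pose m := \sum_(i in K :\: L) f i.
have mE j : ray_pairing m j = \sum_(i in K :\: L)
    ((tnth q k)%:Z * (j == i)%:R - (tnth q i)%:Z * (j == k)%:R).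
  by rewrite ray_pairing_sum; apply: eq_bigr => i _; rewrite fE.
have mK j : j \in K -> ray_pairing m j =
    \sum_(i in K :\: L) (tnth q k)%:Z * (j == i)%:R.
  move=> jK; rewrite mE; apply: eq_bigr => i _.
  have /negPf -> : j != k by apply: contraNneq kK => <-.
  by rewrite mulr0 subr0.
exists m; split=> j jK.
- by rewrite mK//; apply: sumr_ge0 => i _; rewrite mulr_ge0// ler0n.
- rewrite mE; apply: sumr_le0 => i; rewrite inE => /andP[iL _].
  have /negPf -> : j != i by apply: contraNneq iL => <-.
  by rewrite mulr0 sub0r oppr_le0 mulr_ge0// ler0n.
- move=> jL; rewrite mK// (bigD1 j) ?inE ?jK ?jL//= eqxx mulr1.
  by rewrite ltr_pwDl ?ltz_nat ?q_gt0// sumr_ge0// => i _; rewrite mulr_ge0// ler0n.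
Qed.

(** The n rays other than v_k are linearly independent: by
    exists_ray_functional their matrix has a right inverse up to the nonzero
    factor q_k. *)
Lemma ray_pairing_inj (k : 'I_n.+1) m :
  (forall j, j != k -> ray_pairing m j = 0) -> m = 0.
Proof.
move=> m0; have [f fE] := choice (fun j => exists_ray_functional (lift k j) k).
pose V := \matrix_(j < n) fan_ray q (lift k j).
pose B := \matrix_(l < n, j < n) f j l 0.
have VB : V *m B = (tnth q k)%:Z%:M.
  apply/matrixP => j l.
  transitivity (ray_pairing (f l) (lift k j)).
    by rewrite /ray_pairing !mxE; apply: eq_bigr => a _; rewrite !mxE.
  rewrite fE !mxE (inj_eq lift_inj) [lift k j == k]eq_sym (negPf (neq_lift _ _)) mulr0 subr0.
  by rewrite mulr_natr.
have V0 : \det V != 0.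
  have : \det (V *m B) != 0.
    rewrite VB det_scalar expf_neq0//; apply/eqP; have := q_gt0 k; lia.
  by rewrite det_mulmx mulf_eq0 negb_or => /andP[].
have Vm : V *m m = 0.
  apply/colP => j; rewrite [RHS]mxE -(m0 (lift k j)) 1?eq_sym ?neq_lift//.
  by rewrite /ray_pairing !mxE; apply: eq_bigr => a _; rewrite mxE.
have : \adj V *m V *m m = 0 by rewrite -mulmxA Vm mulmx0.
rewrite mul_adj_mx mul_scalar_mx => /colP Vm0; apply/colP => j.
by have /eqP := Vm0 j; rewrite !mxE mulf_eq0 (negPf V0) => /eqP.
Qed.

End RayPairing.

(** * Extension of characters *)

Section CharacterExtension.
Variables (C : numClosedFieldType) (n : nat).

Definition monomial (z : 'I_n -> C) (u : 'rV[int]_n) : C :=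
  \prod_j z j ^ (u 0 j).

Lemma monomial0 z : monomial z 0 = 1.
Proof. by apply: big1 => j _; rewrite mxE expr0z. Qed.

Lemma monomialB z u u' : (forall j, z j != 0) ->
  monomial z (u - u') = monomial z u / monomial z u'.
Proof.
move=> z0; rewrite -prodf_div; apply: eq_bigr => j _.
by rewrite !mxE expfzDr// invr_expz.
Qed.

Definition subgroup (V : zmodType) (H : set V) :=
  H 0 /\ forall u u', H u -> H u' -> H (u - u').

Lemma subgroupMz (V : zmodType) (H : set V) u (c : int) :
  subgroup H -> H u -> H (u *~ c).
Proof.
move=> [H0 HB] Hu; have HN x : H x -> H (- x) by rewrite -sub0r; exact: HB.
have Hn m : H (u *+ m).
  elim: m => [|m IH]; first by rewrite mulr0n.
  by rewrite mulrSr -[X in _ + X]opprK; apply: HB => //; exact: HN.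
by case: c => m; [exact: Hn|rewrite NegzE mulrNz; exact/HN/Hn].
Qed.

(** One coordinate of Z^n at a time. Let H_k be the subgroup of the vectors of H
    supported on the first k coordinates, and suppose that chi is a monomial on
    H_k. The next coordinates of the vectors of H_(k+1) are the multiples of
    some d; if d > 0, choose u1 in H_(k+1) with this coordinate equal to d. It
    is enough to make chi and the monomial agree at u1, that is, to extract a
    d-th root. *)
Lemma extend_character (H : set 'rV[int]_n) (chi : 'rV[int]_n -> C) :
  subgroup H -> (forall u, H u -> chi u != 0) ->
  (forall u u', H u -> H u' -> chi (u - u') = chi u / chi u') ->
  exists2 z, forall j, z j != 0 & forall u, H u -> chi u = monomial z u.
Proof.
move=> [H0 HB] chi0 chiB.
have chi1 : chi 0 = 1.
  by rewrite -[X in chi X](subrr 0) chiB// divff// chi0.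
have agree z : (forall j, z j != 0) ->
    subgroup [set u | H u /\ chi u = monomial z u].
  move=> z0; split=> [|u u' [Hu Eu] [Hu' Eu']]; first by rewrite /= chi1 monomial0.
  by split; [exact: HB|rewrite chiB// Eu Eu' monomialB].
suff main k : (k <= n)%N -> exists2 z : 'I_n -> C, forall j, z j != 0 &
    forall u, H u -> (forall j : 'I_n, (k <= j)%N -> u 0 j = 0) ->
      chi u = monomial z u.
  have [z z0 Ez] := main n (leqnn n); exists z => // u Hu; apply: Ez => // j.
  by rewrite leqNgt ltn_ord.
elim: k => [_|k IH kn].
  exists (fun=> 1) => [j|u Hu u0]; first exact: oner_neq0.
  have -> : u = 0 by apply/rowP => j; rewrite mxE u0.
  by rewrite chi1 monomial0.
have [z z0 Ez] := IH (ltnW kn).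
pose j0 := Ordinal kn.
pose Hk := [set u | H u /\ forall j : 'I_n, (k < j)%N -> u 0 j = 0].
have HkG : subgroup Hk.
  split=> [|u u' [Hu Eu] [Hu' Eu']]; first by split=> // j _; rewrite mxE.
  by split=> [|j kj]; [exact: HB|rewrite !mxE Eu// Eu'// subrr].
(* The least d in P generates the group of the coordinates j0 of the vectors
   of Hk. *)
pose P d := `[< (0 < d)%N /\ exists2 u, Hk u & u 0 j0 = d%:Z >].
have Habs u : Hk u -> u 0 j0 != 0 -> P (absz (u 0 j0)).
  move=> Hu u0; apply/asboolP; split; first by rewrite absz_gt0.
  have [u_ge0|/ltW u_le0] := leP 0 (u 0 j0).
    by exists u => //; rewrite gez0_abs.
  exists (u *~ -1); first exact: subgroupMz.
  by rewrite mulrNz mulr1z mxE lez0_abs.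
have [exP|nP] := pselect (exists d, P d); last first.
  exists z => // u Hu u0; apply: Ez => // j kj.
  have [jk|jk] := eqVneq j j0; last first.
    by apply: u0; rewrite ltn_neqAle kj andbT; apply: contra jk => /eqP jk; apply/eqP/val_inj.
  apply/eqP/negPn/negP; rewrite jk => u_neq0; apply: nP.
  by exists (absz (u 0 j0)); exact: Habs.
case: (ex_minnP exP) => d /asboolP[d0 [u1 Hu1 u1d]] dmin.
pose y := chi u1 / \prod_(j | j != j0) z j ^ (u1 0 j).
pose z' j := if j == j0 then d.-root y else z j.
have rootd : d.-root y ^ u1 0 j0 = y by rewrite u1d -exprnP rootCK.
have y0 : y != 0.
  rewrite mulf_neq0 ?chi0 ?invr_neq0//; first by case: Hu1.
  by apply/prodf_neq0 => j _; rewrite expfz_neq0.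
have z'0 j : z' j != 0 by rewrite /z'; case: ifP => // _; rewrite rootC_eq0.
exists z' => // u Hu uk.
have G := agree z' z'0.
have G1 : [set u | H u /\ chi u = monomial z' u] u1.
  split; first by case: Hu1.
  rewrite /monomial (bigD1 j0)//= {1}/z' eqxx rootd.
  under [X in _ * X]eq_bigr => j jj0 do rewrite /z' (negPf jj0).
  rewrite divfK//; apply/prodf_neq0 => j _; exact: expfz_neq0.
pose c := divz (u 0 j0) d; pose u2 := u - u1 *~ c.
have Hku : Hk u by split.
have Hu2 : Hk u2 by apply HkG => //; exact: subgroupMz.
have u2j0 : u2 0 j0 = modz (u 0 j0) d.
  by rewrite !mxE -scaler_int mxE u1d /modz intz.
have {}u2j0 : u2 0 j0 = 0.
  apply/eqP/negPn/negP => /(Habs _ Hu2)/dmin.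
  have := ltz_pmod (u 0 j0) (d0 : 0 < d%:Z).
  by have := modz_ge0 (u 0 j0) (lt0n_neq0 d0 : d%:Z != 0); rewrite u2j0; lia.
have G2 : [set u | H u /\ chi u = monomial z' u] u2.
  split; first by case: Hu2.
  rewrite Ez; [|by case: Hu2|].
    apply: eq_bigr => j _; rewrite /z'.
    by case: eqP => // ->; rewrite u2j0.
  move=> j; rewrite leq_eqVlt => /orP[/eqP kj|]; last by case: Hu2 => _; apply.
  by have -> : j = j0 by exact: val_inj.
have [] // : [set u | H u /\ chi u = monomial z' u] u.
have -> : u = u2 - u1 *~ (- c) by rewrite mulrNz opprK subrK.
by apply G => //; exact: subgroupMz.
Qed.

End CharacterExtension.

(** * Cones of the fan and functionals *)

Section Cones.
Variables (R : realType) (n : nat) (q : n.+1.-tuple nat).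
Hypothesis q_gt0 : forall j, (0 < tnth q j)%N.

Lemma pairing_sum (J : {set 'I_n.+1}) (a : 'I_n.+1 -> R) m :
  pairing (\sum_(j in J) a j *: lattice_point R (fan_ray q j)) m =
  \sum_(j in J) a j * (ray_pairing q m j)%:~R.
Proof.
rewrite /pairing mulmx_suml summxE; apply: eq_bigr => j _.
rewrite -scalemxAl mxE; congr (_ * _).
exact: pairing_lattice.
Qed.

Lemma dual_coneP (J : {set 'I_n.+1}) m :
  dual_monoid (fan_cone R q J) m <->
  forall j, j \in J -> 0 <= ray_pairing q m j.
Proof.
split=> [mJ j jJ|mJ x [a a0 ->]]; last first.
  by rewrite pairing_sum; apply: sumr_ge0 => j jJ; rewrite mulr_ge0// ler0z mJ.
have := mJ _ (fan_ray_cone R q jJ).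
by rewrite pairing_lattice ler0z.
Qed.

Lemma perp_coneP (J : {set 'I_n.+1}) m :
  perp (fan_cone R q J) m <-> forall j, j \in J -> ray_pairing q m j = 0.
Proof.
split=> [mJ j jJ|mJ x [a a0 ->]]; last first.
  by rewrite pairing_sum; apply: big1 => j jJ; rewrite mJ// mulr0.
have := mJ _ (fan_ray_cone R q jJ).
by rewrite pairing_lattice => /eqP; rewrite intr_eq0 => /eqP.
Qed.

Lemma fan_coneS (J K : {set 'I_n.+1}) :
  J \subset K -> fan_cone R q J `<=` fan_cone R q K.
Proof.
move=> JK x [a a0 ->].
exists (fun i => if i \in J then a i else 0) => [i|]; first by case: ifP.
rewrite [RHS](big_setID J)/= [X in _ + X]big1 ?addr0.
  rewrite (finset.setIidPr JK); apply: eq_bigr => i ->.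
  by [].
by move=> i; rewrite inE => /andP[/negPf -> _]; rewrite scale0r.
Qed.

(** Two combinations of the rays that agree differ by a multiple of the
    relation sum_j q_j v_j = 0, so the differences of their coefficients are
    all positive, all negative or all zero. A ray j of J outside K would give a
    positive difference and a ray k outside J a nonpositive one. The functional of exists_ray_functional for j and k
    exhibits the contradiction. *)
Lemma cone_support (J K : {set 'I_n.+1}) (a b : 'I_n.+1 -> R) :
  J \proper [set: 'I_n.+1]%SET ->
  (forall j, j \in J -> 0 < a j) -> (forall j, 0 <= b j) ->
  \sum_(j in J) a j *: lattice_point R (fan_ray q j) =
  \sum_(j in K) b j *: lattice_point R (fan_ray q j) -> J \subset K.
Proof.
move=> /properP[_ [k _ kJ]] a0 b0 E; apply/fintype.subsetP => j jJ.
apply/negPn/negP => jK.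
have [m Hm] := exists_ray_functional q_gt0 j k.
have kj : k != j by apply: contraNneq kJ => ->.
have /eqP := congr1 (fun x => pairing x m) E; rewrite !pairing_sum.
apply/negP; rewrite gt_eqF//; apply: (@le_lt_trans _ _ 0).
  apply: sumr_le0 => i iK; rewrite mulr_ge0_le0// lerz0 Hm.
  have [ij|_] := eqVneq i j; first by rewrite -ij iK in jK.
  by rewrite mulr0 sub0r oppr_le0 mulr_ge0// ler0n.
rewrite (bigD1 j)//= big1 ?addr0 => [|i /andP[iJ ij]].
  rewrite Hm eqxx eq_sym (negPf kj) mulr0 subr0 mulr1 mulr_gt0 ?a0//.
  by rewrite ltr0z; exact: q_gt0.
rewrite Hm (negPf ij) mulr0; have [ik|] := eqVneq i k.
  by rewrite -ik iJ in kJ.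
by rewrite mulr0 subr0 mulr0.
Qed.

(** No ray lies in a cone generated by others. Properness of J matters: for
    n = 0 the only ray is zero and lies in every cone. *)
Lemma rays_in_cone (J K : {set 'I_n.+1}) : J \proper [set: 'I_n.+1]%SET ->
  (forall j, j \in J -> fan_cone R q K (lattice_point R (fan_ray q j))) ->
  J \subset K.
Proof.
move=> Jp JK; apply/fintype.subsetP => j jJ; have [b b0 E] := JK _ jJ.
rewrite -finset.sub1set; apply: (@cone_support _ _ (fun=> 1) b) => //.
- by apply: sub_proper_trans Jp; rewrite finset.sub1set.
- by rewrite finset.big_set1 scale1r.
Qed.

End Cones.

(** * Affine charts are surjective *)

Section DualMonoid.
Variables (R : realType) (n : nat).
Local Notation C := (R[i]^o).
Implicit Types (s : set 'rV[R]_n) (m : 'cV[int]_n).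

Lemma dual_monoid0 s : dual_monoid s 0.
Proof. by move=> x _; rewrite /pairing map_mx0 mulmx0 mxE. Qed.

Lemma dual_monoidD s m m' :
  dual_monoid s m -> dual_monoid s m' -> dual_monoid s (m + m').
Proof. by move=> sm sm' x sx; rewrite pairingD addr_ge0 ?sm ?sm'. Qed.

Lemma dual_monoidMn s m c : dual_monoid s m -> dual_monoid s (m *+ c).
Proof.
move=> sm; elim: c => [|c IH]; first exact: dual_monoid0.
by rewrite mulrS; exact: dual_monoidD.
Qed.

Lemma dual_monoidS s t : s `<=` t -> dual_monoid t `<=` dual_monoid s.
Proof. by move=> st m tm x /st; exact: tm. Qed.

Variables (s : set 'rV[R]_n) (f : 'cV[int]_n -> C).
Hypothesis sf : affine_toric s f.

Lemma affine_toricMn m c : dual_monoid s m -> f (m *+ c) = f m ^+ c.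
Proof.
have [f0 fD _] := sf; move=> sm; elim: c => [|c IH]; first by rewrite f0 expr0.
by rewrite mulrS fD// ?IH ?exprS//; exact: dual_monoidMn.
Qed.

Lemma affine_toric_sum (I : finType) (F : I -> 'cV[int]_n) :
  (forall i, dual_monoid s (F i)) -> f (\sum_i F i) = \prod_i f (F i).
Proof.
have [f0 fD _] := sf; move=> sF.
suff [] : dual_monoid s (\sum_i F i) /\ f (\sum_i F i) = \prod_i f (F i) by [].
apply: (big_rec2 (fun x y => dual_monoid s x /\ f x = y)).
  by split; [exact: dual_monoid0|].
move=> i y x _ [sx fx]; split; first exact: dual_monoidD.
by rewrite fD// fx.
Qed.

(** The inclusion of the affine piece of a face into that of a larger cone. *)
Lemma affine_toric_restrict t : s `<=` t ->
  affine_toric t (fun m => if m \in dual_monoid t then f m else 0).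
Proof.
have [f0 fD _] := sf; move=> st; split=> [|m m' tm tm'|m tm].
- by rewrite mem_set//; exact: dual_monoid0.
- rewrite !mem_set//; last exact: dual_monoidD.
  by apply: fD; exact: (dual_monoidS st).
- by rewrite memNset.
Qed.

End DualMonoid.

Section ChartSurjective.
Variables (R : realType) (n : nat) (q : n.+1.-tuple nat) (k : 'I_n.+1).
Hypothesis q_gt0 : forall j, (0 < tnth q j)%N.
Local Notation C := (R[i]^o).

Local Notation sigma := (maximal_cone (R := R) q k).

Lemma dual_maximal_coneP m :
  dual_monoid sigma m <->
  forall j : 'I_n, 0 <= ray_pairing q m (lift k j).
Proof.
rewrite dual_coneP; split=> [mP j|mP j].
  by apply: mP; rewrite !inE eq_sym neq_lift.
by rewrite !inE; case: (unliftP k j) => [i -> _|->]; [exact: mP|rewrite eqxx].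
Qed.

Lemma exists_dual_basis : exists e : 'I_n -> 'cV[int]_n, forall i j : 'I_n,
  ray_pairing q (e i) (lift k j) = (tnth q k)%:Z *+ (j == i).
Proof.
have [e eE] := choice (fun i => exists_ray_functional q_gt0 (lift k i) k).
exists e => i j; rewrite eE (inj_eq lift_inj) [lift k j == k]eq_sym.
by rewrite (negPf (neq_lift _ _)) mulr0 subr0 mulr_natr.
Qed.

Lemma dual_basis_sum (e : 'I_n -> 'cV[int]_n) m : (forall i j : 'I_n,
    ray_pairing q (e i) (lift k j) = (tnth q k)%:Z *+ (j == i)) ->
  m *+ tnth q k = \sum_j e j *~ ray_pairing q m (lift k j).
Proof.
move=> eE; apply/eqP; rewrite -subr_eq0; apply/eqP.
apply: (@ray_pairing_inj _ q q_gt0 k) => i.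
rewrite eq_sym => /unlift_some[j -> _].
rewrite ray_pairingD ray_pairingN ray_pairing_sum -scaler_nat ray_pairingZ.
rewrite (bigD1 j)//= big1 ?addr0 => [|l lj].
  by rewrite -scaler_int ray_pairingZ eE eqxx mulr1n !intz natz mulrC subrr.
by rewrite -scaler_int ray_pairingZ eE eq_sym (negPf lj) mulr0.
Qed.

(** Let e_j be the dual basis up to the factor q_k. Since q_k m is the sum of
    the <v_j, m> e_j, the value f m is nonzero if and only if f (e_j) is nonzero
    for every j with <v_j, m> nonzero. Hence the coordinates z_j with
    f (e_j) = 0 have to vanish, and the others only need to reproduce f on the
    monoid Phi where f is nonzero. There f is invertible, so it extends to a
    character of the group generated by Phi, and then to Z^n by
    extend_character. *)
Lemma chart_fun_surj f : affine_toric sigma f ->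
  exists z : 'rV[C]_n, forall m, f m = chart_fun q k z m.
Proof.
move=> fP; have [f0 fD fN] := fP.
have [e eE] := exists_dual_basis.
have eP j : dual_monoid sigma (e j).
  by apply/dual_maximal_coneP => i; rewrite eE mulrn_wge0.
have fX m : dual_monoid sigma m ->
    f m ^+ tnth q k = \prod_j f (e j) ^+ absz (ray_pairing q m (lift k j)).
  move=> mP; rewrite -(affine_toricMn fP)// (dual_basis_sum _ eE).
  have coef j : e j *~ ray_pairing q m (lift k j) =
      e j *+ absz (ray_pairing q m (lift k j)).
    by rewrite -[in RHS]mulrz_nat natz gez0_abs//; exact: (dual_maximal_coneP m).1.
  rewrite (eq_bigr _ (fun j _ => coef j)).
  rewrite (affine_toric_sum fP) => [|j]; last exact: dual_monoidMn.
  by apply: eq_bigr => j _; rewrite (affine_toricMn fP).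
pose Phi := [set m | dual_monoid sigma m /\ f m != 0].
have PhiD m m' : Phi m -> Phi m' -> Phi (m + m').
  move=> [Pm fm] [Pm' fm']; split; first exact: dual_monoidD.
  by rewrite fD// mulf_neq0.
have Phi0 : Phi 0 by split; [exact: dual_monoid0|rewrite f0 oner_neq0].
pose co m : 'rV[int]_n := \row_j ray_pairing q m (lift k j).
have coD m m' : co (m + m') = co m + co m'.
  by apply/rowP => j; rewrite !mxE ray_pairingD.
have co_inj : injective co.
  move=> m m' /rowP E; apply/eqP; rewrite -subr_eq0; apply/eqP.
  apply: (@ray_pairing_inj _ q q_gt0 k) => i.
  rewrite eq_sym => /unlift_some[j -> _]; have := E j; rewrite !mxE.
  by rewrite ray_pairingD ray_pairingN => ->; rewrite subrr.
have chi_ex u : exists y, forall m m', Phi m -> Phi m' -> u = co m - co m' ->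
    y = f m / f m'.
  have [[m [m' [Pm Pm' uE]]]|nu] :=
      pselect (exists m m', [/\ Phi m, Phi m' & u = co m - co m']); last first.
    by exists 0 => m m' Pm Pm' uE; case: nu; exists m, m'.
  exists (f m / f m') => p p' Pp Pp'; rewrite uE => /eqP.
  rewrite subr_eq addrAC eq_sym subr_eq -!coD => /eqP/co_inj E.
  have [[Dm fm] [Dm' fm']] := (Pm, Pm'); have [[Dp fp] [Dp' fp']] := (Pp, Pp').
  apply/eqP; rewrite eqr_div//; apply/eqP.
  by rewrite -!fD// E.
have [chi chiE] := choice chi_ex.
pose H := [set u | exists m m', [/\ Phi m, Phi m' & u = co m - co m']].
have HB u u' : H u -> H u' -> H (u - u') /\ chi (u - u') = chi u / chi u'.
  move=> [m [m' [Pm Pm' uE]]] [p [p' [Pp Pp' u'E]]].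
  have E : u - u' = co (m + p') - co (m' + p).
    by rewrite uE u'E !coD; apply/rowP => j; rewrite !mxE; ring.
  split; first by exists (m + p'), (m' + p); split=> //; exact: PhiD.
  rewrite (chiE _ _ _ (PhiD _ _ Pm Pp') (PhiD _ _ Pm' Pp) E).
  rewrite (chiE _ _ _ Pm Pm' uE) (chiE _ _ _ Pp Pp' u'E).
  have [[Dm fm] [Dm' fm']] := (Pm, Pm'); have [[Dp fp] [Dp' fp']] := (Pp, Pp').
  by rewrite !fD// invf_div mulf_div.
have Hco m : Phi m -> H (co m) /\ chi (co m) = f m.
  move=> Pm; have E : co m = co m - co 0.
    by apply/rowP => j; rewrite !mxE ray_pairing0 subr0.
  split; first by exists m, 0.
  by rewrite (chiE _ _ _ Pm Phi0 E) f0 divr1.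
have [|||z z0 zE] := @extend_character R[i] n H chi.
- split=> [|u u' Hu Hu']; last by have [] := HB _ _ Hu Hu'.
  by exists 0, 0; split=> //; rewrite subrr.
- move=> u [m [m' [Pm Pm' uE]]]; rewrite (chiE _ _ _ Pm Pm' uE).
  by rewrite mulf_neq0 ?invr_eq0//; [case: Pm|case: Pm'].
- by move=> u u' Hu Hu'; have [] := HB _ _ Hu Hu'.
exists (\row_j if f (e j) == 0 then 0 else z j) => m.
rewrite /chart_fun; have [/set_mem mP|mP] := boolP (m \in _); last first.
  by apply: fN; apply: contraNnot mP => mP; rewrite mem_set.
have [fm0|fm0] := eqVneq (f m) 0.
  have /eqP := fX _ mP.
  rewrite fm0 expr0n gtn_eqF ?q_gt0// eq_sym => /prodf_eq0[j _].
  rewrite expf_eq0 => /andP[mj ej].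
  apply/esym/eqP; rewrite prodf_seq_eq0/=; apply/hasP; exists j.
    by rewrite mem_index_enum.
  by rewrite mxE ej expf_eq0 mj eqxx.
have [Hm chim] := Hco _ (conj mP fm0).
rewrite -chim zE//; apply: eq_bigr => j _.
rewrite -/(ray_pairing q m (lift k j)) mxE.
have := (dual_maximal_coneP m).1 mP j.
have : f m ^+ tnth q k != 0 by rewrite expf_neq0.
rewrite fX// => /prodf_neq0/(_ j isT).
set r := ray_pairing q m (lift k j) => ej r0; rewrite mxE.
have [E|_] := eqVneq (f (e j)) 0; last by rewrite -[in LHS](gez0_abs r0).
by move: ej; rewrite E expf_eq0 eqxx andbT -eqn0Ngt absz_eq0 => /eqP ->.
Qed.

End ChartSurjective.

(** * The union of the orbits below a given set of rays *)

Section Star.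
Variables (R : realType) (n : nat) (q : n.+1.-tuple nat).
Hypothesis q_gt0 : forall j, (0 < tnth q j)%N.
Local Notation C := (R[i]^o).
Local Notation piece := (affine_pieces (fan R q)).

(** For a point f of the affine piece of s, the condition that it lies in the
    closed orbit-union attached to J, expressed so that it is visibly closed
    in f. *)
Definition vanishes_along (J : {set 'I_n.+1}) (s : set 'rV[R]_n)
    (f : 'cV[int]_n -> C) :=
  (forall j, j \in J -> s (lattice_point R (fan_ray q j))) /\
  (forall m, dual_monoid s m ->
     (exists2 j, j \in J & ray_pairing q m j != 0) -> f m = 0).

Definition piece_vanishes (J : {set 'I_n.+1}) : set piece :=
  [set x : piece | vanishes_along J (set_val (tag x)) (set_val (tagged x))].

(** For J proper, the union of the orbits O_K with J contained in K; see
    orbit_star and orbit_starE. *)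
Definition star (J : {set 'I_n.+1}) : set (wproj R q) :=
  [set p | exists2 x, toric_point x = p & piece_vanishes J x].

Lemma piece_cone (x : piece) :
  exists2 K : {set 'I_n.+1}, K \proper [set: 'I_n.+1]%SET &
    set_val (tag x) = fan_cone R q K.
Proof. exact: (set_valP (tag x)). Qed.

Lemma piece_affine (x : piece) :
  affine_toric (set_val (tag x)) (set_val (tagged x)).
Proof. exact: set_valP. Qed.

(** Take m0 nonnegative on s, nonpositive on t and positive on the rays of s
    outside t. Both m0 and - m0 are in the dual monoid of the intersection, so
    F m0 is nonzero. Vanishing along J then forces m0 to be 0 on the rays of J,
    which therefore lie in t. Moreover any m in the dual monoid of t becomes an
    element of the dual monoid of s after adding a multiple of m0; this changes
    neither whether F vanishes at m nor the values of m on J. *)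
Lemma vanishes_along_glue J s t (f f' F : 'cV[int]_n -> C) :
  fan R q s -> fan R q t -> affine_toric (s `&` t) F ->
  (forall m, dual_monoid s m -> f m = F m) ->
  (forall m, dual_monoid t m -> f' m = F m) ->
  vanishes_along J s f -> vanishes_along J t f'.
Proof.
move=> [K Kp ->] [L Lp ->] FP fF f'F [JK f_van]; have [F0 FD _] := FP.
have [m0 [m0K m0L m0KL]] := exists_separating_functional q_gt0 L Kp.
have dK : dual_monoid (fan_cone R q K) m0 by apply/dual_coneP.
have dL : dual_monoid (fan_cone R q L) (- m0).
  by apply/dual_coneP => j jL; rewrite ray_pairingN oppr_ge0 m0L.
have dKI := dual_monoidS (@subIsetl _ (fan_cone R q K) (fan_cone R q L)).
have dLI := dual_monoidS (@subIsetr _ (fan_cone R q K) (fan_cone R q L)).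
(* F is multiplicative on m0 and - m0, whose sum is 0. *)
have Fm0 : F m0 != 0.
  have : F (m0 + - m0) != 0 by rewrite subrr F0 oner_neq0.
  by rewrite FD ?mulf_eq0 ?negb_or; [case/andP|exact: dKI|exact: dLI].
have m0J j : j \in J -> ray_pairing q m0 j = 0.
  move=> jJ; apply/eqP/negPn/negP => m0j; move: Fm0; rewrite -fF// f_van ?eqxx//.
  by exists j.
split=> [j jJ|m mL [j jJ mj]].
  have [a a0 aE] := JK j jJ.
  have /eqP := congr1 (fun x => pairing x m0) aE.
  rewrite pairing_lattice -[((_ *m m0) 0 0)]/(ray_pairing q m0 j) m0J// mulr0z.
  rewrite pairing_sum eq_sym psumr_eq0 => [/allP am|i iK]; last first.
    by rewrite mulr_ge0// ler0z m0K.
  suff : fan_cone R q (K :&: L) (lattice_point R (fan_ray q j)).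
    by apply: fan_coneS; exact: finset.subsetIr.
  exists a => //; rewrite aE (big_setID L)/= [X in _ + X]big1 ?addr0// => i.
  rewrite inE => /andP[iL iK]; have := am i; rewrite mem_index_enum iK => /(_ isT).
  by rewrite /= mulf_eq0 intr_eq0 [X in _ || X]gt_eqF ?m0KL// orbF => /eqP ->; rewrite scale0r.
(* N bounds the values of m, so m + N m0 is nonnegative on s. *)
rewrite f'F//; pose N := (\sum_i absz (ray_pairing q m i))%N.
have dKm : dual_monoid (fan_cone R q K) (m + m0 *+ N).
  apply/dual_coneP => i iK.
  rewrite ray_pairingD -scaler_nat ray_pairingZ.
  have [iL|iL] := boolP (i \in L).
    apply: addr_ge0; first by move/dual_coneP: mL; apply.
    by rewrite mulr_ge0 ?m0K// ler0n.
  have : (absz (ray_pairing q m i) <= N)%N by rewrite /N (bigD1 i)//= leq_addr.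
  by have := m0KL i iK iL; rewrite natz; nia.
have := f_van _ dKm; rewrite fF// FD; [|exact: dLI|exact/dKI/dual_monoidMn].
rewrite (affine_toricMn FP); last exact: dKI.
move=> FmN; have /eqP : F m * F m0 ^+ N = 0.
  apply: FmN; exists j => //.
  by rewrite ray_pairingD -scaler_nat ray_pairingZ m0J// mulr0 addr0.
by rewrite mulf_eq0 expf_eq0 (negPf Fm0) andbF orbF => /eqP.
Qed.

Lemma piece_vanishes_glue J (x y : piece) :
  Defs.glue x y -> piece_vanishes J x <-> piece_vanishes J y.
Proof.
have xF := piece_cone x; have yF := piece_cone y; move=> [F FP [fx fy]].
by split; apply: (vanishes_along_glue (F := F)) => //; rewrite setIC.
Qed.

Lemma piece_vanishes_point J (x y : piece) :
  toric_point x = toric_point y -> piece_vanishes J x <-> piece_vanishes J y.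
Proof.
move=> /eqmodP/asboolP; elim=> [{}x {}y|{}x|{}x {}y _|{}x {}y z _ xy _] //.
- exact: piece_vanishes_glue.
- by move=> ->.
- by rewrite xy.
Qed.

Lemma star_point J (x : piece) : star J (toric_point x) <-> piece_vanishes J x.
Proof.
split=> [[y yx yJ]|xJ]; last by exists x.
exact/(piece_vanishes_point _ yx).
Qed.

Lemma orbit_star (J K : {set 'I_n.+1}) :
  J \subset K -> toric_orbit (fan R q) (fan_cone R q K) `<=` star J.
Proof.
move=> JK p [x [<- xK [t _ xt]]]; apply/star_point.
split=> [j jJ|m _ [j jJ mj]].
  by rewrite xK; apply: fan_ray_cone; exact: (fintype.subsetP JK).
rewrite xt; case: (boolP (m \in _)) => [/set_mem/perp_coneP mK|_]; last by rewrite mulr0.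
by move: mj; rewrite mK ?eqxx//; exact: (fintype.subsetP JK).
Qed.

(** Converse of orbit_star. *)
Lemma orbit_starE (J K : {set 'I_n.+1}) p : J \proper [set: 'I_n.+1]%SET ->
  toric_orbit (fan R q) (fan_cone R q K) p -> star J p -> J \subset K.
Proof.
move=> Jp [x [<- xK _]] /star_point[+ _]; rewrite xK.
exact: rays_in_cone.
Qed.

Lemma chart_pieceE k (z : 'rV[C]_n) :
  set_val (tagged (chart_piece q k z)) = chart_fun q k z.
Proof. by []. Qed.

(** A point of the affine piece of K is seen in the chart of every maximal cone
    that contains K. The coordinates that vanish are read off by evaluating at
    the dual basis of the maximal cone. *)
Lemma piece_chart (x : piece) (K : {set 'I_n.+1}) k :
  set_val (tag x) = fan_cone R q K -> k \notin K ->
  exists2 z : 'rV[C]_n, toric_point x = chart q k z &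
    forall J j, piece_vanishes J x -> lift k j \in J -> z 0 j = 0.
Proof.
move=> xK kK.
have sub : set_val (tag x) `<=` maximal_cone (R := R) q k.
  rewrite xK; apply: fan_coneS; apply/fintype.subsetP => i iK.
  by rewrite !inE; apply: contraNneq kK => <-.
have [z zE] := chart_fun_surj q_gt0 (affine_toric_restrict (piece_affine x) sub).
have xz : toric_point x = chart q k z.
  apply/eqmodP/asboolP/Relation_Operators.rst_step.
  exists (set_val (tagged x)) => /=.
    by rewrite setIidl//; exact: piece_affine.
  split=> // m mk; transitivity (chart_fun q k z m) => //.
  by rewrite -zE mem_set.
exists z => // J j xJ jJ; have [e eE] := exists_dual_basis k q_gt0.
have ej : dual_monoid (maximal_cone (R := R) q k) (e j).
  by apply/dual_maximal_coneP => i; rewrite eE mulrn_wge0.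
have [_ van] := (piece_vanishes_point J
  (xz : toric_point x = toric_point (chart_piece q k z))).1 xJ.
have := van _ ej; rewrite chart_pieceE /chart_fun mem_set// (bigD1 j)//= => zj.
have /eqP : z 0 j ^+ tnth q k * \prod_(i < n | i != j)
  z 0 i ^+ absz (ray_pairing q (e j) (lift k i)) = 0.
  rewrite -zj.
    by rewrite -[(fan_ray _ _ *m _) 0 0]/(ray_pairing q (e j) (lift k j)) eE eqxx.
  exists (lift k j) => //; rewrite eE eqxx; have := q_gt0 k.
  by rewrite -lt0n.
rewrite big1 ?mulr1 => [|i /negPf ij]; last by rewrite eE ij.
by rewrite expf_eq0 => /andP[_ /eqP].
Qed.

Lemma star_chart (J : {set 'I_n.+1}) p : J \proper [set: 'I_n.+1]%SET ->
  star J p -> exists k (z : 'rV[C]_n), [/\ k \notin J, p = chart q k z &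
    forall j, lift k j \in J -> z 0 j = 0].
Proof.
move=> Jp [x <- xJ]; have [K Kp xK] := piece_cone x.
have JK : J \subset K by apply: (rays_in_cone (R := R)) => //; rewrite -xK; case: xJ.
have /properP[_ [k _ kK]] := Kp; have [z xz zJ] := piece_chart xK kK.
exists k, z; split=> // [|j jJ]; last exact: zJ xJ jJ.
by apply: contraNN kK => /(fintype.subsetP JK).
Qed.

(** All the charts that meet star J cover the orbit O_J. This is what makes the
    sheets of the inertia space connected. *)
Lemma orbit_chart (J : {set 'I_n.+1}) k p : k \notin J ->
  toric_orbit (fan R q) (fan_cone R q J) p ->
  exists2 z : 'rV[C]_n, p = chart q k z & forall j, lift k j \in J -> z 0 j = 0.
Proof.
move=> kJ pJ; have [x [xp xJ _]] := pJ; have [z xz zJ] := piece_chart xJ kJ.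
exists z => [|j jJ]; first by rewrite -xp.
by apply: zJ jJ; apply/star_point; rewrite xp; exact: (orbit_star (fintype.subxx _) pJ).
Qed.

End Star.

(** * Orbit closures *)

Lemma mx_continuous (T U : topologicalType) m n (g : T -> 'M[U]_(m, n)) :
  (forall i j, continuous (fun t => g t i j)) -> continuous g.
Proof.
move=> cg t A [P PA sP].
have : \forall s \near t, forall i j, P i j (g s i j).
  by apply: filter_forall => i; apply: filter_forall => j; exact: cg.
by apply: filterS => s Ps; exact: sP.
Qed.

Lemma real_complex_continuous (R : realType) :
  continuous (fun t : R => t%:C%C : R[i]^o).
Proof.
move=> t; apply/(@cvgrPdist_lt R[i]) => e.
rewrite ltcE /= => /andP[/eqP e_im e_re].
have -> : e = (complex.Re e)%:C%C by case: e e_im {e_re} => x y /= ->.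
near=> s; rewrite -rmorphB normc_def/= expr0n addr0 sqrtr_sqr ltcR.
by near: s; apply: cvgr_dist_lt.
Unshelve. all: by end_near. Qed.

Section StarTopology.
Variables (R : realType) (n : nat) (q : n.+1.-tuple nat).
Hypothesis q_gt0 : forall j, (0 < tnth q j)%N.
Local Notation C := (R[i]^o).

Lemma affine_toric_eval_continuous (s : set 'rV[R]_n) m :
  continuous (fun f : affine_toric s => (set_val f : {ptws 'cV[int]_n -> C}) m).
Proof.
move=> f; apply: (@continuous_comp _ _ _ (set_val : affine_toric s -> {ptws 'cV[int]_n -> C}) (proj m)).
  exact: initial_continuous.
exact: proj_continuous.
Qed.

(** In each affine piece star J is the locus where the evaluations at certain
    m vanish, or is empty. *)
Lemma star_closed (J : {set 'I_n.+1}) : closed (star J : set (wproj R q)).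
Proof.
rewrite -openC; apply/sigT_openP => s.
have [sJ|sJ] := pselect (forall j, j \in J ->
    set_val s (lattice_point R (fan_ray q j))); last first.
  rewrite [X in open X](_ : _ = setT); first exact: openT.
  by rewrite -subTset => f _ /(star_point q_gt0) [].
pose D := [set m | dual_monoid (set_val s) m /\
  exists2 j, j \in J & ray_pairing q m j != 0].
rewrite [X in open X](_ : _ =
    ~` \bigcap_(m in D) [set f : affine_toric (set_val s) |
       (set_val f : {ptws 'cV[int]_n -> C}) m = 0]); last first.
  apply/seteqP; split=> f; apply: contra_not.
    by move=> fD; apply/(star_point q_gt0); split=> // m mS mj; exact: fD.
  by move=> /(star_point q_gt0)[_ fD] m [mS mj]; exact: fD.
rewrite openC; apply: closed_bigI => m _.
apply: (@preimage_closed _ _ (fun f : affine_toric (set_val s) => (set_val f : {ptws 'cV[int]_n -> C}) m) [set 0]).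
  by move=> f _; exact: affine_toric_eval_continuous.
exact: (accessible_closed_set1 (hausdorff_accessible (@norm_hausdorff _ C))).
Qed.

Lemma expr_continuous (K : numFieldType) e : continuous (fun x : K^o => x ^+ e).
Proof.
move=> x; elim: e => [|e /(continuousM cvg_id) IH]; first exact: cst_continuous.
by rewrite /continuous_at exprS; under eq_fun do rewrite exprS; exact: IH.
Qed.

Lemma chart_fun_continuous k m :
  continuous (fun z : 'rV[C]_n => (chart_fun q k z : 'cV[int]_n -> C) m).
Proof.
rewrite /chart_fun; case: (m \in dual_monoid _); last exact: cst_continuous.
apply: (@continuous_big C _ (@GRing.mul R[i]) 1 xpredT) => [|j _]; first exact: (@mul_continuous R[i]).
move=> z; apply: (@continuous_comp _ _ _ (fun z : 'rV[C]_n => z 0 j)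
  (fun x : C => x ^+ absz ((fan_ray q (lift k j) *m m) 0 0))).
  exact: (@coord_continuous R[i]).
exact: expr_continuous.
Qed.

Lemma chart_continuous k : continuous (chart (R := R) q k).
Proof.
have cont : continuous (fun z : 'rV[C]_n =>
    SigSub (mem_set (chart_fun_affine q k z)) : affine_toric (maximal_cone q k)).
  apply: continuous_comp_initial => z; set g := _ \o _.
  have FF : Filter (g @ z) by apply: fmap_filter; exact: nbhs_filter.
  apply/cvg_sup => m; move: z {FF}.
  apply: continuous_comp_initial.
  exact: chart_fun_continuous.
move=> z; apply: (@continuous_comp _ _ _ (chart_piece (R := R) q k)
  (@toric_point R n (fan R q))); last exact: pi_continuous.
move=> U; rewrite /= => /cont.
exact.
Qed.

Lemma zero_face_eq (J : {set 'I_n.+1}) k (z : 'rV[C]_n) : k \notin J ->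
  (forall j, (z 0 j == 0) = (lift k j \in J)) -> zero_face k z = J.
Proof.
move=> kJ zJ; apply/setP => i; apply/imsetP/idP => [[j + ->]|iJ].
  by rewrite inE zJ.
have /unlift_some[j ij _] : k != i by apply: contraNneq kJ => ->.
by exists j => //; rewrite inE zJ -ij.
Qed.

Lemma orbit_nonempty (J : {set 'I_n.+1}) : J \proper [set: 'I_n.+1]%SET ->
  toric_orbit (fan R q) (fan_cone R q J) !=set0.
Proof.
move=> /properP[_ [k _ kJ]].
pose z : 'rV[C]_n := \row_j (lift k j \notin J)%:R.
have zJ : zero_face k z = J.
  by apply: zero_face_eq => // j; rewrite mxE; case: (_ \in J); rewrite ?eqxx ?oner_eq0.
by exists (chart q k z); rewrite -{1}zJ; exact: chart_orbit.
Qed.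

(** A point of star J is chart k z with z vanishing on J; making the other zero
    coordinates of z equal to a small nonzero number gives points of O_J that
    converge to it. *)
Lemma orbit_closure (J : {set 'I_n.+1}) : J \proper [set: 'I_n.+1]%SET ->
  closure (toric_orbit (fan R q) (fan_cone R q J)) = star J.
Proof.
move=> Jp; apply/seteqP; split.
  rewrite [X in _ `<=` X](iffLR (closure_id _) (@star_closed J)).
  by apply: closureS; exact: orbit_star.
move=> p /(star_chart q_gt0 Jp)[k [z [kJ -> zJ]]] U Uz.
(* The coordinates that vanish without being forced to by J become t. *)
pose path (t : C) : 'rV[C]_n :=
  \row_j (z 0 j + t * ((z 0 j == 0) && (lift k j \notin J))%:R).
have path_cont : continuous path.
  apply: mx_continuous => a j.
  rewrite [X in continuous X](_ : _ = fun t : C =>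
    (z 0 j : C) + t * ((z 0 j == 0) && (lift k j \notin J))%:R); last first.
    by apply/funext => t; rewrite mxE.
  move=> t; exact: (cvgD (cvg_cst (z 0 j : C)) (@mulrr_continuous R[i] _ t)).
have path0 : path 0 = z by apply/rowP => j; rewrite mxE mul0r addr0.
have : nbhs (0 : C) ((chart q k \o path) @^-1` U).
  apply: (continuous_comp (path_cont _) (@chart_continuous k _)).
  by rewrite /= path0.
move=> /nbhs_ballP[e e0 eU]; exists (chart q k (path (e / 2))); split; last first.
  apply: eU; rewrite /ball/= sub0r normrN gtr0_norm ?divr_gt0//.
  by rewrite ltr_pdivrMr// ltr_pMr// ltr1n.
rewrite -{1}(@zero_face_eq J k (path (e / 2)))//; first exact: chart_orbit.
move=> j; rewrite mxE; have [zj0|zj0] /= := eqVneq (z 0 j) 0; last first.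
  rewrite mulr0 addr0 (negPf zj0); apply/esym/negP => jJ.
  by rewrite zJ ?eqxx in zj0.
rewrite zj0 add0r; case: (_ \in J); rewrite ?mulr0 ?eqxx// mulr1.
by rewrite gt_eqF// divr_gt0.
Qed.

(** O_J lies in star J, and the points of O_J lie in star K only if K is
    contained in J. *)
Lemma star_inj (J K : {set 'I_n.+1}) :
  J \proper [set: 'I_n.+1]%SET -> K \proper [set: 'I_n.+1]%SET ->
  (star J : set (wproj R q)) = star K -> J = K.
Proof.
have sub (A B : {set 'I_n.+1}) : A \proper [set: 'I_n.+1]%SET ->
    B \proper [set: 'I_n.+1]%SET -> (star A : set (wproj R q)) = star B ->
    A \subset B.
  move=> Ap Bp AB; have [p pB] := orbit_nonempty Bp.
  apply: (orbit_starE q_gt0 Ap pB); rewrite AB.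
  exact: (orbit_star q_gt0 (fintype.subxx B) pB).
by move=> Jp Kp JK; apply/eqP; rewrite finset.eqEsubset !sub.
Qed.

End StarTopology.

(** * Components of the inertia space *)

Section TwistedSectors.
Variables (R : realType) (n : nat) (q : n.+1.-tuple nat).
Hypothesis q_gt0 : forall j, (0 < tnth q j)%N.
Local Notation C := (R[i]^o).

Definition interior_box (J : {set 'I_n.+1}) (g : 'rV[int]_n) : Prop :=
  exists2 a : 'I_n.+1 -> R, (forall j, j \in J -> 0 < a j < 1) &
    lattice_point R g = \sum_(j in J) a j *: lattice_point R (fan_ray q j).

(** Drop the zero coefficients. *)
Lemma box_interior (K : {set 'I_n.+1}) g : box R q K g ->
  exists2 J : {set 'I_n.+1}, J \subset K & interior_box J g.
Proof.
move=> [a a01 gE]; exists [set j in K | a j != 0]%SET.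
  by apply/fintype.subsetP => j; rewrite inE => /andP[].
exists a => [j|]; last first.
  rewrite gE (bigID (fun j => a j != 0))/= [X in _ + X]big1 ?addr0; last first.
    by move=> j /andP[_]; rewrite negbK => /eqP ->; rewrite scale0r.
  by apply: eq_bigl => j; rewrite inE.
by rewrite inE => /andP[_ aj]; have /andP[a0 ->] := a01 j; rewrite lt_def aj a0.
Qed.

Lemma interior_box_subset (J K : {set 'I_n.+1}) g : J \proper [set: 'I_n.+1]%SET ->
  interior_box J g -> box R q K g -> J \subset K.
Proof.
move=> Jp [a a01 gE] [b b01 gE']; apply: (cone_support q_gt0 (a := a) (b := b)) => //.
- by move=> j /a01/andP[].
- by move=> j; have /andP[] := b01 j.
- by rewrite -gE gE'.
Qed.

(** The fixed locus of g in the chart contains the coordinate subspace cut out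
    by J: on the other coordinates g acts by expi 0 = 1. *)
Lemma interior_coordinates (J : {set 'I_n.+1}) g k : interior_box J g -> k \notin J ->
  exists a, box_coordinates q k a g /\
    forall z : 'rV[C]_n, (forall j, lift k j \in J -> z 0 j = 0) ->
      diag_action a z = z.
Proof.
move=> [a a01 gE] kJ.
exists (fun j => if lift k j \in J then a (lift k j) else 0); split.
  split=> [j|].
    by case: ifP => [/a01/andP[/ltW -> ->]//|_]; rewrite lexx ltr01.
  rewrite gE big_mkcond (bigD1_ord k)//= (negPf kJ) add0r.
  by apply: eq_bigr => j _; case: ifP => // _; rewrite scale0r.
move=> z zJ; apply/rowP => j; rewrite mxE.
case: ifP => [/zJ ->|_]; first by rewrite mulr0.
by rewrite mulr0 /expi cos0 sin0 mul1r.
Qed.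

Lemma local_group_star (J : {set 'I_n.+1}) g (p : wproj R q) :
  J \proper [set: 'I_n.+1]%SET -> interior_box J g ->
  local_group p g <-> star J p.
Proof.
move=> Jp gJ; split=> [[K [_ pK gK]]|pJ].
  exact: orbit_star (interior_box_subset Jp gJ gK) _ pK.
have [k [z [kJ -> zJ]]] := star_chart q_gt0 Jp pJ.
have [a [ag az]] := interior_coordinates gJ kJ.
by apply: chart_local_group ag _; exact: az.
Qed.

Lemma inertia_ext (x y : inertia R q) : inertia_point x = inertia_point y ->
  inertia_elt x = inertia_elt y -> x = y.
Proof.
rewrite /inertia_point /inertia_elt => xy1 xy2; apply: val_inj.
by move: xy1 xy2; rewrite !set_valE; case: (val x) (val y) => [? ?] [? ?] /= -> ->.
Qed.

Lemma inertia_exists (p : wproj R q) g : local_group p g ->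
  exists x : inertia R q, inertia_point x = p /\ inertia_elt x = g.
Proof.
move=> pg; have pgP : [set x : wproj R q * 'rV[int]_n | local_group x.1 x.2] (p, g).
  by [].
by exists (SigSub (mem_set pgP)).
Qed.

Lemma inertia_local_group (x : inertia R q) :
  local_group (inertia_point x) (inertia_elt x).
Proof. exact: (set_valP x). Qed.

Lemma inertia_chart_continuous k (a : 'I_n -> R) g (ag : box_coordinates q k a g) :
  continuous (inertia_chart ag).
Proof. by apply/continuousP => W; exact. Qed.

(** Each chart of the inertia space takes a single value of g, so its preimage
    of any set defined through g is empty or everything. *)
Lemma sheet_clopen g : clopen [set y : inertia R q | inertia_elt y = g].
Proof.
have chart_sheet (P : set 'rV[int]_n) :
    open [set y : inertia R q | P (inertia_elt y)].
  move=> k a h ah; have [Ph|Ph] := pselect (P h).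
    rewrite [X in open X](_ : _ = setT); first exact: openT.
    by apply/seteqP; split.
  rewrite [X in open X](_ : _ = set0); first exact: open0.
  by apply/seteqP; split.
split; first exact: (chart_sheet [set g]).
by rewrite -openC; exact: (chart_sheet (~` [set g])).
Qed.

Lemma connected_clopen_sub (T : topologicalType) (B S : set T) x :
  connected B -> B x -> clopen S -> S x -> B `<=` S.
Proof.
move=> cB Bx [oS cS] Sx; rewrite -(cB (B `&` S)); first exact: subIsetr.
- by exists x.
- by exists S.
- by exists S.
Qed.

(** Both points are in the image of one chart, at two points of the fixed
    locus; the line that joins these stays in the fixed locus. *)
Lemma inertia_component_base (J : {set 'I_n.+1}) (x y : inertia R q) :
  J \proper [set: 'I_n.+1]%SET -> interior_box J (inertia_elt y) ->
  toric_orbit (fan R q) (fan_cone R q J) (inertia_point x) ->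
  inertia_elt x = inertia_elt y -> connected_component setT x y.
Proof.
move=> Jp gJ xJ xy; have /(local_group_star _ Jp gJ) := inertia_local_group y.
move=> /(star_chart q_gt0 Jp)[k [z [kJ yz zJ]]].
have [z0 xz0 z0J] := orbit_chart q_gt0 kJ xJ.
have [a [ag az]] := interior_coordinates gJ kJ.
pose line (t : R) : 'rV[C]_n := \row_j (z0 0 j + t%:C%C * (z 0 j - z0 0 j)).
have line_fixed t : fixed_locus a (line t).
  by apply: az => j jJ; rewrite mxE zJ// z0J// subrr mulr0 addr0.
pose fixed_line t : fixed_locus a := SigSub (mem_set (line_fixed t)).
have line_cont : continuous fixed_line.
  apply: continuous_comp_initial; apply: mx_continuous => i j.
  rewrite [X in continuous X](_ : _ = fun t : R =>
    (z0 0 j : C) + (t%:C%C : C) * (z 0 j - z0 0 j)); last first.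
    by apply/funext => t; rewrite /= mxE.
  move=> t; exact: (cvgD (cvg_cst (z0 0 j : C)) (continuous_comp
    (@real_complex_continuous R t) (@mulrr_continuous R[i] _ _))).
exists (range (inertia_chart ag \o fixed_line)); last first.
  exists 1 => //; apply: inertia_ext => //=.
  rewrite yz; congr chart; apply/rowP => j.
  by rewrite /= mxE mul1r addrC subrK.
split=> //.
- exists 0 => //; apply: inertia_ext => //=.
  by rewrite xz0; congr chart; apply/rowP => j; rewrite /= mxE mul0r addr0.
- apply: connected_continuous_connected; first exact/connected_intervalP.
  apply: continuous_subspaceT => t; apply: continuous_comp; first exact: line_cont.
  exact: inertia_chart_continuous.
Qed.

(** The set of the pairs with a given second entry is clopen, and each of them is
    joined to one fixed pair over a point of O_J. *)
Lemma inertia_componentE (J : {set 'I_n.+1}) (x : inertia R q) :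
  J \proper [set: 'I_n.+1]%SET -> interior_box J (inertia_elt x) ->
  connected_component setT x = [set y | inertia_elt y = inertia_elt x].
Proof.
move=> Jp gJ; apply/seteqP; split=> [y|y /= yx].
  apply: (connected_clopen_sub (@component_connected _ setT x) _
    (sheet_clopen (inertia_elt x))) => //.
  exact: connected_component_refl.
have [p pJ] := orbit_nonempty R q Jp.
have [b [bp bx]] : exists b : inertia R q,
    inertia_point b = p /\ inertia_elt b = inertia_elt x.
  apply: inertia_exists; apply/(local_group_star _ Jp gJ).
  exact: orbit_star pJ.
rewrite -bp in pJ.
apply: (connected_component_trans (y := b)); last first.
  by apply: (inertia_component_base Jp) => //; rewrite ?yx.
by apply: connected_component_sym; exact: (inertia_component_base Jp).
Qed.

Lemma inertia_component_image (J : {set 'I_n.+1}) (x : inertia R q) :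
  J \proper [set: 'I_n.+1]%SET -> interior_box J (inertia_elt x) ->
  @inertia_point R n q @` connected_component setT x = star J.
Proof.
move=> Jp gJ; rewrite (inertia_componentE Jp gJ); apply/seteqP; split=> p.
  move=> [y yx <-]; apply/(local_group_star _ Jp gJ).
  by rewrite -yx; exact: inertia_local_group.
by move=> /(local_group_star _ Jp gJ)/inertia_exists[y [yp yg]]; exists y.
Qed.

Lemma twisted_sectorP (J : {set 'I_n.+1}) : J \proper [set: 'I_n.+1]%SET ->
  is_twisted_sector (closure (toric_orbit (fan R q) (fan_cone R q J))) <->
  exists2 g, g != 0 & interior_box J g.
Proof.
move=> Jp; rewrite orbit_closure//; split=> [[x [x0 JE]]|[g g0 gJ]].
  have [K [Kp _ /box_interior[L LK xL]]] := inertia_local_group x.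
  have Lp := sub_proper_trans LK Kp; exists (inertia_elt x) => //.
  suff -> : J = L by [].
  by apply: (@star_inj R n q q_gt0 J L Jp Lp); rewrite JE; exact: inertia_component_image.
have [p pJ] := orbit_nonempty R q Jp.
have /inertia_exists[x [_ xg]] : local_group p g.
  by apply/(local_group_star _ Jp gJ); exact: orbit_star pJ.
exists x; rewrite xg; split=> //.
by rewrite (inertia_component_image Jp)// xg.
Qed.

End TwistedSectors.

(** * Lattice vectors inside a box *)

Section InteriorLatticePoints.
Variables (R : realType) (n : nat) (q : n.+1.-tuple nat).
Hypothesis q_gt0 : forall j, (0 < tnth q j)%N.

Lemma gcd_weights_dvd (J : {set 'I_n.+1}) j :
  j \in J -> (gcd_weights q J %| tnth q j)%N.
Proof. by move=> jJ; apply: (biggcdn_inf j). Qed.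

Lemma gcd_weights_Bezout (J : {set 'I_n.+1}) :
  exists c : 'I_n.+1 -> int,
    \sum_(j in J) (tnth q j)%:Z * c j = (gcd_weights q J)%:Z.
Proof.
pose K x := exists c : 'I_n.+1 -> int, \sum_(j in J) (tnth q j)%:Z * c j = x%:Z.
apply: (big_ind K) => [|x y [c cx] [c' c'y]|j jJ].
- by exists (fun=> 0); apply: big1 => j _; rewrite mulr0.
- have [u [v uv]] := Bezoutz x%:Z y%:Z.
  exists (fun j => u * c j + v * c' j).
  transitivity (gcdz x y) => //; rewrite -uv -cx -c'y !mulr_sumr -big_split/=.
  by apply: eq_bigr => j _; ring.
- exists (fun i => (i == j)%:R); rewrite (bigD1 j)//= eqxx mulr1 big1 ?addr0//.
  by move=> i /andP[_ /negPf ->]; rewrite mulr0.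
Qed.

Lemma lattice_point_sum (c : 'I_n.+1 -> int) :
  lattice_point R (\sum_j c j *: fan_ray q j) =
  \sum_j (c j)%:~R *: lattice_point R (fan_ray q j).
Proof.
apply/rowP => l; rewrite mxE !summxE rmorph_sum.
by apply: eq_bigr => j _; rewrite !mxE rmorphM.
Qed.

Lemma lattice_ray_relation :
  \sum_j (tnth q j)%:R *: lattice_point R (fan_ray q j) = 0.
Proof.
rewrite -(lattice_point_sum (fun j => (tnth q j)%:Z)) fan_ray_relation//.
by apply/rowP => l; rewrite !mxE.
Qed.

(** A divisibility would turn Bezout's relation into an integral functional
    equal to 1 on v_j and 0 on the other rays of J, whose value at g is the
    coefficient of v_j. *)
Lemma interior_box_not_dvd (J : {set 'I_n.+1}) g j : interior_box R q J g ->
  j \in J -> ~~ (gcd_weights q (~: J) %| tnth q j)%N.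
Proof.
move=> [a a01 gE] jJ; apply/negP => /dvdnP[e qj].
have [c cE] := gcd_weights_Bezout (~: J).
have [|m mE] := ray_pairing_surj q_gt0
  (u := fun l => (l == j)%:R - (l \in ~: J)%:R * (e%:Z * c l)).
  under eq_bigr do rewrite mulrBr.
  rewrite sumrB sum_indicator qj PoszM -cE mulr_sumr big_mkcond -sumrB.
  by apply: big1 => l _; case: (_ \in _); rewrite ?mul0r ?mulr0 ?subr0// mul1r; ring.
have := congr1 (fun x => pairing x m) gE.
rewrite pairing_lattice pairing_sum (bigD1 j)//= big1 ?addr0 => [|l /andP[lJ lj]].
  rewrite mE eqxx inE jJ mul0r subr0 mulr1 => aj.
  by have := a01 j jJ; rewrite -aj ltr0z ltrz1; lia.
by rewrite mE (negPf lj) inE lJ mul0r subr0 mulr0.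
Qed.

(** The fractional parts of q_j / d: they vanish outside J, and
    sum_j (q_j / d) v_j = 0, so the vector equals minus the sum of the integral
    parts. *)
Lemma interior_box_exists (J : {set 'I_n.+1}) : J \proper [set: 'I_n.+1]%SET ->
  (forall j, j \in J -> ~~ (gcd_weights q (~: J) %| tnth q j)%N) ->
  exists g, interior_box R q J g.
Proof.
move=> /properP[_ [k _ kJ]]; set d := gcd_weights q _ => dJ.
have d0 : (0 < d)%N.
  by apply: (dvdn_gt0 (q_gt0 k)); apply: gcd_weights_dvd; rewrite inE.
exists (- \sum_j (tnth q j %/ d)%:Z *: fan_ray q j).
exists (fun j => (tnth q j %% d)%:R / d%:R) => [j jJ|].
  rewrite divr_gt0 ?ltr0n// ?lt0n ?dJ// ltr_pdivrMr ?ltr0n// mul1r ltr_nat.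
  exact: ltn_pmod.
have -> : lattice_point R (- \sum_j (tnth q j %/ d)%:Z *: fan_ray q j) =
    - \sum_j (tnth q j %/ d)%:R *: lattice_point R (fan_ray q j).
  rewrite -(lattice_point_sum (fun j => (tnth q j %/ d)%:Z)).
  by apply/rowP => l; rewrite !mxE rmorphN.
rewrite [RHS]big_mkcond/=; apply/esym/eqP; rewrite -addr_eq0 -big_split/=.
apply/eqP; transitivity
  (d%:R^-1 *: \sum_j (tnth q j)%:R *: lattice_point R (fan_ray q j)); last first.
  by rewrite lattice_ray_relation scaler0.
rewrite scaler_sumr; apply: eq_bigr => j _; rewrite scalerA.
have dE : (tnth q j)%:R = (tnth q j %/ d)%:R * d%:R + (tnth q j %% d)%:R :> R.
  by rewrite -natrM -natrD -divn_eq.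
have dR : d%:R != 0 :> R by rewrite pnatr_eq0 -lt0n.
case: ifP => jJ; first by rewrite -scalerDl dE; congr (_ *: _); field.
have jd : (tnth q j %% d = 0)%N.
  by apply/eqP; apply: gcd_weights_dvd; rewrite inE jJ.
by rewrite add0r dE jd addr0 mulrC mulfK.
Qed.

Lemma interior_box_neq0 (J : {set 'I_n.+1}) : J \proper [set: 'I_n.+1]%SET ->
  J != finset.set0 -> ~ interior_box R q J 0.
Proof.
move=> Jp J0 [a a01 aE]; have : J \subset finset.set0.
  apply: (cone_support q_gt0 (R := R) (a := a) (b := fun=> 0)) => //.
    by move=> j /a01/andP[].
  by rewrite -aE big_set0; apply/rowP => l; rewrite !mxE.
by rewrite finset.subset0 (negPf J0).
Qed.

(** Adding one weight to a family leaves the gcd unchanged exactly when the gcd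
    divides that weight. *)
Lemma gcd_maximalP (J : {set 'I_n.+1}) :
  (forall j, j \in J -> ~~ (gcd_weights q (~: J) %| tnth q j)%N) <->
  (forall K : {set 'I_n.+1}, ~: J \proper K ->
     gcd_weights q K <> gcd_weights q (~: J)).
Proof.
split=> [dJ K /properP[_ [j jK jJ]] KE|dJ j jJ].
  move: jJ; rewrite inE negbK => /dJ; rewrite -KE => /negP; apply.
  exact: gcd_weights_dvd.
apply/negP => dj; apply: (dJ (j |: ~: J)%SET).
  by apply: properUr; rewrite finset.sub1set inE negbK.
by rewrite /gcd_weights big_setU1 ?inE ?jJ//=; apply/gcdn_idPr.
Qed.

End InteriorLatticePoints.

Theorem theorem4p3p5 (R : realType) (n : nat) (q : n.+1.-tuple nat)
    (q_gt0 : forall j : 'I_n.+1, (0 < tnth q j)%N)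
    (q_gcd : gcd_weights q [set: 'I_n.+1]%SET = 1%N)
    (i : nat) (i_gt0 : (0 < i)%N) (i_le_n : (i <= n)%N) :
  let tau := fan_cone R q [set j : 'I_n.+1 | (j < i)%N]%SET in
  let Q_tau := [set j : 'I_n.+1 | (i <= j)%N]%SET in
  let d := gcd_weights q Q_tau in
  is_twisted_sector (closure (toric_orbit (fan R q) tau)) <->
  (forall J : {set 'I_n.+1}, Q_tau \proper J -> gcd_weights q J <> d).
Proof.
move=> tau Q_tau d; pose J := [set j : 'I_n.+1 | (j < i)%N]%SET.
have QE : Q_tau = (~: J)%SET by apply/setP => j; rewrite !inE -leqNgt.
have Jp : J \proper [set: 'I_n.+1]%SET.
  rewrite properT; apply/eqP => /setP/(_ (Ordinal (i_le_n : i < n.+1)%N)).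
  by rewrite !inE ltnn.
have J0 : J != finset.set0 by apply/set0Pn; exists ord0; rewrite inE.
rewrite /d QE -gcd_maximalP /tau -/J twisted_sectorP//.
split=> [[g _ gJ] j|dJ]; first exact: interior_box_not_dvd gJ.
have [g gJ] := interior_box_exists R q_gt0 Jp dJ; exists g => //.
by apply/eqP => g0; rewrite g0 in gJ; exact: interior_box_neq0 gJ.
Qed.
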